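(* Let $m\ge2$ and $\alpha\le0$. Suppose that the kernel $k_\alpha$ satisfies all of the conditions (1)–(4) listed in the context. Let $X$ and $Y$ be bodies in $\mathbb{R}^m$. Suppose that the complement $Y^c$ satisfies the uniform interior cone condition of aperture angle $\kappa$ and height $\delta$, where $0<\kappa\le\pi$ and $0<\delta\le+\infty$. Let $0<R_0<\operatorname{diam}Y$, and let $\tilde R=\tilde R(\alpha,\kappa,\delta,\operatorname{diam}Y,R_0)$. Then for any $0<b<1$ there exists $\tau>0$ such that if $0<t<\tau$, then for any $x\in X$ with $\operatorname{dist}(x,X^c)\ge R_0$ and any $y\in\mathbb{R}^m$ with $\operatorname{dist}(y,Y^c)\le b\tilde R$, we have $K_Y^{(\alpha)}(y,t)<K_X^{(\alpha)}(x,t)$.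
   Context: A body in $\mathbb{R}^m$ is the closure of a bounded open set. $X^c$ is the complement of $X$ and $B_\rho(x)$ the closed ball of radius $\rho$ centered at $x$. For a kernel $k_\alpha(r,t)$ ($r>0$, $t>0$) and a body $\Omega$, $K_\Omega^{(\alpha)}(x,t)=\int_\Omega k_\alpha(|x-\xi|,t)\,d\xi$ for $x\in\mathbb{R}^m$, $t>0$. Conditions on $k_\alpha$: (1) for each $t>0$, $k_\alpha(\cdot,t)$ is strictly decreasing and satisfies condition $(C^0_\beta)$ for some $\beta>0$, i.e. it is continuous on $(0,+\infty)$ and as $r\to0^+$ it is $O(r^{\beta-m})$ if $\beta<m$, $O(\log r)$ if $\beta=m$, $O(1)$ if $\beta>m$. (2) There are positive functions $\psi(t)$ and $\bar k_\alpha(r,t)$ with $k_\alpha(r,t)=\psi(t)\bar k_\alpha(r,t)$ such that $\bar k_\alpha(r,t)\to r^{\alpha-m}$ as $t\to0^+$ for each $r>0$. (3) $\int_{\mathbb{R}^m}k_\alpha(|\xi|,t)\,d\xi=1$ for each $t>0$. (4) $\lim_{t\to0^+}\int_{\mathbb{R}^m\setminus B_\rho(0)}k_\alpha(|\xi|,t)\,d\xi=0$ for each $\rho>0$. The open cone of vertex $x$, axis direction $v\in S^{m-1}$, aperture angle $\kappa$ and height $\delta$ is $\{x+\rho w: 0<\rho<\delta,\ w\in S^{m-1},\ w\cdot v>\cos(\kappa/2)\}$. An open set $U$ satisfies the uniform interior cone condition of aperture angle $\kappa$ and height $\delta$ if for each $x\in U$ there is an open cone of vertex $x$, aperture angle $\kappa$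 and height $\delta$ contained in $U$. Definition of $\tilde R$: let $C_\theta(x;\kappa,\delta)$ be the open cone of vertex $x$, axis direction $\cos\theta\, e_1+\sin\theta\, e_m$, aperture angle $\kappa$ and height $\delta$. For $D>0$, $0<R_0<D$ and $R>0$ put $E(R)=\min_{0\le\theta\le(\pi-\kappa)/2}\left(\int_{C_\theta(Re_1;\kappa,\delta)\cap B_D(0)}|\xi|^{\alpha-m}d\xi-\int_{B_D(0)\setminus B_{R_0}(0)}|\xi|^{\alpha-m}d\xi\right).$ There is a unique positive number $\tilde R=\tilde R(\alpha,\kappa,\delta,D,R_0)$ with $E(\tilde R)=0$; moreover $E(R)>0$ for $R<\tilde R$, $E(R)<0$ for $R>\tilde R$, and $\tilde R<R_0$. *)

(* Defs.v *)
From HB Require Import structures.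
From mathcomp Require Import all_boot all_order all_algebra.
From mathcomp Require Import all_classical all_reals all_analysis.

Set Implicit Arguments.
Unset Strict Implicit.
Unset Printing Implicit Defensive.

Import Order.TTheory GRing.Theory Num.Theory.
Import numFieldNormedType.Exports.

Local Open Scope classical_set_scope.
Local Open Scope ring_scope.

(* Lebesgue measure on R^n, carried by the row vectors 'rV[R]_n.  The
   sigma-algebra is the one generated by the coordinates (the Borel sets), and
   the measure is built by recursion on n from the library's product measure. *)

Section measurable_rV.
Context {R : realType}.
Variable n : nat.

Definition rV_coord (i : 'I_n) (v : 'rV[R]_n) : measurableTypeR R := v ord0 i.

Let rV_set0 : g_sigma_preimage rV_coord set0.
Proof. exact: sigma_algebra0. Qed.

Let rV_setC A : g_sigma_preimage rV_coord A -> g_sigma_preimage rV_coord (~` A).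
Proof. exact: sigma_algebraC. Qed.

Let rV_bigcup (F : _^nat) : (forall i, g_sigma_preimage rV_coord (F i)) ->
  g_sigma_preimage rV_coord (\bigcup_i (F i)).
Proof. exact: sigma_algebra_bigcup. Qed.

HB.instance Definition _ := @isMeasurable.Build default_measure_display
  'rV[R]_n (g_sigma_preimage rV_coord) rV_set0 rV_setC rV_bigcup.

Lemma measurable_rV_coord i : measurable_fun [set: 'rV[R]_n] (rV_coord i).
Proof.
move=> _ Y mY; rewrite setTI; apply: sub_sigma_algebra => /=.
rewrite -bigcup_seq/=; exists i => /=; first by rewrite mem_index_enum.
by exists Y => //; rewrite setTI.
Qed.

Lemma measurable_fun_rVP d (T : measurableType d) (f : T -> 'rV[R]_n) :
  measurable_fun [set: T] f <->
  forall i, measurable_fun [set: T] (rV_coord i \o f).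
Proof.
split=> [mf i|mf].
  by apply: measurableT_comp => //; exact: measurable_rV_coord.
move=> _ A; rewrite setTI; move: A; apply: smallest_sub.
  split.
  - by rewrite /= preimage_set0; exact: measurable0.
  - move=> A mA /=; rewrite setTD preimage_setC.
    exact: measurableC.
  - by move=> F mF /=; rewrite preimage_bigcup; exact: bigcupT_measurable.
move=> A; rewrite -bigcup_seq => -[i _ [B mB <-]] /=; rewrite setTI.
by have := mf i measurableT B mB; rewrite setTI.
Qed.

End measurable_rV.

Lemma sigma_finite_product d1 d2 (T1 : measurableType d1)
    (T2 : measurableType d2) (R : realType)
    (m1 : {sigma_finite_measure set T1 -> \bar R})
    (m2 : {sigma_finite_measure set T2 -> \bar R}) :
  sigma_finite [set: T1 * T2] (m1 \x m2)%E.
Proof.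
have /sigma_finiteP[F [TF ndF Foo]] := sigma_finiteT m1.
have /sigma_finiteP[G [TG ndG Goo]] := sigma_finiteT m2.
exists (fun n => F n `*` G n).
  rewrite -setXTT TF TG predeqE => -[x y]; split.
    move=> [/= [n _ Fnx] [k _ Gky]]; exists (maxn n k) => //; split.
    - by move: x Fnx; exact/subsetPset/ndF/leq_maxl.
    - by move: y Gky; exact/subsetPset/ndG/leq_maxr.
  by move=> [n _ []/= ? ?]; split; exists n.
move=> k; have [? ?] := Foo k; have [? ?] := Goo k.
split; first exact: measurableX.
by rewrite product_measure1E// lte_mul_pinfty// ge0_fin_numE.
Qed.

Section rV_cons.
Context {R : realType}.
Variable n : nat.

Definition rV_cons (p : measurableTypeR R * 'rV[R]_n) : 'rV[R]_n.+1 :=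
  \row_(i < n.+1) (if unlift ord0 i is Some j then p.2 ord0 j else p.1).

Lemma measurable_rV_cons : measurable_fun [set: _] rV_cons.
Proof.
apply/measurable_fun_rVP => i.
case: (unliftP ord0 i) => [j|] ->.
  rewrite (_ : _ \o _ = rV_coord j \o snd).
    by apply: measurableT_comp => //; exact: measurable_rV_coord.
  by apply/funext => p /=; rewrite /rV_coord mxE liftK.
rewrite (_ : _ \o _ = fst) //.
by apply/funext => p /=; rewrite /rV_coord mxE unlift_none.
Qed.

Lemma bijective_rV_cons : bijective rV_cons.
Proof.
exists (fun v : 'rV[R]_n.+1 =>
  (rV_coord ord0 v, \row_(j < n) v ord0 (lift ord0 j))) => [[x v]|v] /=.
  rewrite /rV_coord mxE unlift_none; congr pair.
  by apply/rowP => j; rewrite !mxE liftK.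
by apply/rowP => i; rewrite mxE /rV_coord; case: unliftP => [j|] -> //=; rewrite mxE.
Qed.

Section measure.
Variable mu : {sigma_finite_measure set 'rV[R]_n -> \bar R}.

Definition rV_cons_measure : set 'rV[R]_n.+1 -> \bar R :=
  pushforward (lebesgue_measure \x mu)%E rV_cons.

Let ge0 A : (0 <= rV_cons_measure A)%E.
Proof. by rewrite /rV_cons_measure /pushforward measure_ge0. Qed.

Let sadd : semi_sigma_additive rV_cons_measure.
Proof.
move=> F mF tF mUF; rewrite /rV_cons_measure /pushforward preimage_bigcup.
have mpre (A : set 'rV[R]_n.+1) : measurable A -> measurable (rV_cons @^-1` A).
  by move=> mA; rewrite -[X in measurable X]setTI; exact: measurable_rV_cons.
apply: measure_semi_sigma_additive.
- by move=> i; exact: mpre.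
- apply/trivIsetP => /= i j _ _ ij; rewrite -preimage_setI.
  by move/trivIsetP : tF => /(_ _ _ _ _ ij) ->//; rewrite preimage_set0.
- by rewrite -preimage_bigcup; exact: mpre.
Qed.

Let m0 : rV_cons_measure set0 = 0%E.
Proof. by rewrite /rV_cons_measure /pushforward preimage_set0 measure0. Qed.

HB.instance Definition _ := isMeasure.Build _ _ _ rV_cons_measure m0 ge0 sadd.

Let sfin : sigma_finite [set: 'rV[R]_n.+1] rV_cons_measure.
Proof.
have [g fg gf] := bijective_rV_cons.
have mg : measurable_fun [set: 'rV[R]_n.+1] g.
  rewrite (_ : g = fun v => (rV_coord ord0 v, \row_(j < n) v ord0 (lift ord0 j))).
    apply/measurable_fun_pair; first exact: measurable_rV_coord.
    apply/measurable_fun_rVP => i.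
    rewrite (_ : _ \o _ = rV_coord (lift ord0 i)); first exact: measurable_rV_coord.
    by apply/funext => v; rewrite /rV_coord /= mxE.
  apply/funext => v; apply: (can_inj fg); rewrite gf.
  apply/rowP => i; rewrite mxE /rV_coord.
  by case: unliftP => [j|] -> //=; rewrite mxE.
have [F TF mF] := sigma_finite_product lebesgue_measure mu.
exists (fun i => g @^-1` F i).
  by rewrite -preimage_bigcup -TF preimage_setT.
move=> i; have [mFi Fioo] := mF i; split.
  by rewrite -[X in measurable X]setTI; exact: mg.
by rewrite /rV_cons_measure /pushforward -comp_preimage (_ : g \o rV_cons = id)//;
  apply/funext => p /=; rewrite fg.
Qed.

HB.instance Definition _ :=
  Measure_isSigmaFinite.Build _ _ _ rV_cons_measure sfin.

End measure.
End rV_cons.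

Fixpoint lebesgue_rV {R : realType} n :
    {sigma_finite_measure set 'rV[R]_n -> \bar R} :=
  if n is n'.+1 then rV_cons_measure (lebesgue_rV n') else \d_(0 : 'rV[R]_0).

Lemma lebesgue_rV_box {R : realType} n (A : 'I_n -> set (measurableTypeR R)) :
  (forall i, measurable (A i)) ->
  lebesgue_rV n [set v | forall i, A i (rV_coord i v)] =
  (\prod_(i < n) lebesgue_measure (A i))%E.
Proof.
elim: n => [|n ih] in A *.
  move=> _; rewrite big_ord0 /= diracE mem_set//=.
  by case.
move=> mA; rewrite big_ord_recl -(ih (fun i => A (lift ord0 i)))//.
rewrite /= /rV_cons_measure /pushforward.
rewrite (_ : _ @^-1` _ = A ord0 `*`
    [set v | forall i, A (lift ord0 i) (rV_coord i v)]).
  rewrite product_measure1E//.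
  rewrite (_ : [set v | _] = \big[setI/setT]_(i < n)
      (rV_coord i @^-1` A (lift ord0 i))).
    apply: bigsetI_measurable => i _.
    by rewrite -[X in measurable X]setTI; exact: measurable_rV_coord.
  rewrite -bigcap_seq; apply/seteqP; split => v /= H i; last exact/H/mem_index_enum.
  by move=> _; exact: H.
apply/seteqP; split => [[x v] /= H|[x v] /= [Ax Av] i].
  split=> [|i]; first by have := H ord0; rewrite /rV_coord mxE unlift_none.
  by have := H (lift ord0 i); rewrite /rV_coord mxE liftK.
by rewrite /rV_coord mxE; case: unliftP => [j|] ->//; exact: Av.
Qed.

Section euclidean.
Context {R : realType} {m : nat}.
Implicit Types (x y v w xi : 'rV[R]_m) (A : set 'rV[R]_m).

Definition dotp v w : R := \sum_i v ord0 i * w ord0 i.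

(* The library's norm on 'rV[R]_m is the sup norm; it induces the same topology
   as this one, so open, closure and so on below are the library's. *)
Definition enorm v : R := Num.sqrt (dotp v v).

Definition cball x (rho : R) : set 'rV[R]_m := [set y | enorm (y - x) <= rho].

Definition dist x A : R := inf [set enorm (x - a) | a in A].

Definition diam A : R := sup [set enorm (p.1 - p.2) | p in A `*` A].

Definition ebounded A : Prop := exists M : R, forall x, A x -> enorm x <= M.

Definition body A : Prop :=
  exists U : set 'rV[R]_m, [/\ open U, ebounded U & A = closure U].

Definition open_cone x v (kappa : R) (delta : \bar R) : set 'rV[R]_m :=
  [set z | exists rho w, [/\ 0 < rho, (rho%:E < delta)%E, enorm w = 1,
     cos (kappa / 2) < dotp w v & z = x + rho *: w]].

Definition uniform_interior_cone A (kappa : R) (delta : \bar R) : Prop :=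
  open A /\ forall x, A x ->
    exists2 v, enorm v = 1 & open_cone x v kappa delta `<=` A.

(* The i-th vector of the canonical basis, counted from 0: e_1 and e_m are
   basis 0 and basis m.-1. *)
Definition basis (i : nat) : 'rV[R]_m := \row_(j < m) (j == i :> nat)%:R.

(* Extended-real-valued; finite when k satisfies kernel_conditions. *)
Definition potential (k : R -> R -> R) A x (t : R) : \bar R :=
  (\int[lebesgue_rV m]_(xi in A) (k (enorm (x - xi)) t)%:E)%E.

End euclidean.

Section kernels.
Context {R : realType} (m : nat).

Definition cond_C0 (beta : R) (f : R -> R) : Prop :=
  [/\ forall r, 0 < r -> {for r, continuous f},
      beta < m%:R -> f =O_ (0^'+) (fun r => r `^ (beta - m%:R)),
      beta = m%:R -> f =O_ (0^'+) (@ln R)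
    & m%:R < beta -> f =O_ (0^'+) (cst (1 : R))].

(* k is only constrained for r > 0 and t > 0; its other values are immaterial,
   since r = |xi| vanishes on a null set only. *)
Record kernel_conditions (alpha : R) (k : R -> R -> R) : Prop := {
  kernel_decreasing : forall t, 0 < t ->
    forall r s, 0 < r -> r < s -> k s t < k r t;
  kernel_C0 : forall t, 0 < t ->
    exists2 beta, 0 < beta & cond_C0 beta (k^~ t);
  kernel_scaling : exists (psi : R -> R) (kbar : R -> R -> R),
    [/\ forall t, 0 < t -> 0 < psi t,
        forall r t, 0 < r -> 0 < t -> 0 < kbar r t,
        forall r t, 0 < r -> 0 < t -> k r t = psi t * kbar r t
      & forall r, 0 < r ->
          kbar r t @[t --> 0^'+] --> r `^ (alpha - m%:R)];
  kernel_mass : forall t, 0 < t ->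
    (\int[lebesgue_rV m]_xi (k (enorm xi) t)%:E = 1)%E;
  kernel_concentration : forall rho, 0 < rho ->
    (\int[lebesgue_rV m]_(xi in ~` cball (0 : 'rV[R]_m) rho)
       (k (enorm xi) t)%:E @[t --> 0^'+] --> 0)%E
}.

Section Rtilde.
Variables (alpha kappa : R) (delta : \bar R) (D R0 : R).

Definition cone_gap (Rad theta : R) : R :=
  let C : set 'rV[R]_m := open_cone (Rad *: basis 0)
    (cos theta *: basis 0 + sin theta *: basis m.-1) kappa delta in
  \int[lebesgue_rV m]_(xi in C `&` cball 0 D) (enorm xi `^ (alpha - m%:R))
  - \int[lebesgue_rV m]_(xi in cball 0 D `\` cball 0 R0)
      (enorm xi `^ (alpha - m%:R)).

(* E(Rad) = e, where E(Rad) is the minimum of cone_gap Rad over the closed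
   interval [0, (pi - kappa) / 2]. *)
Definition E_eq (Rad e : R) : Prop :=
  let values := [set cone_gap Rad theta | theta in `[0, (pi - kappa) / 2]] in
  values e /\ lbound values e.

(* The unique positive zero of E. *)
Definition Rtilde : R := xget 0 [set Rad | 0 < Rad /\ E_eq Rad 0].

End Rtilde.
End kernels.

(* Main.v *)
Require Import Defs.
From HB Require Import structures.
From mathcomp Require Import all_boot all_order all_algebra.
From mathcomp Require Import all_classical all_reals all_analysis.
From mathcomp Require Import measurable_realfun ring lra.

Import Order.TTheory GRing.Theory Num.Theory.
Import numFieldNormedType.Exports.

Local Open Scope classical_set_scope.
Local Open Scope ring_scope.

Set Implicit Arguments.
Unset Strict Implicit.
Unset Printing Implicit Defensive.

(** Write nu_t for the probability measure with density k(|xi|, t).  After a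
translation the potential of X at x is nu_t(X - x) and that of Y at y is
nu_t(Y - y).  Since dist(x, X^c) >= R0, the set X - x contains the ball B_R0,
so it is enough to show nu_t(Y - y) < nu_t(B_R0) for small t, uniformly in y.

Let D = diam Y, beta = alpha - m, and let rho be the chosen zero of E.  Among
all pairs (p, v) such that the cone of vertex p and axis v avoids Y, choose one
with |p - y| minimal ([closest_cone]).  Every point of Y^c is such a vertex, so
r = |p - y| is at most dist(y, Y^c) <= b rho.

If r = 0, a cone with vertex y avoids Y, and it suffices that nu_t of a cone
with vertex 0 exceeds nu_t(R^m \ B_R0) ([cone_mass_dominates_tail]).  By
compactness N cones cover a ball around 0; they all have the same mass because
nu_t is invariant under orthogonal maps, so each has mass at least about 1/N,
whereas the tail tends to 0 by concentration.

If r > 0, then rho > 0, y lies in Y and Y - y is contained in B_D.  It suffices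
that nu_t(B_D \ B_R0) < nu_t(C(r e, v) & B_D) with e = (p - y)/r
([cone_mass_dominates_annulus]).  The cone does not meet the open ball of radius
r around y, so its directions make an angle at most pi/2 with e, which means
that the angle between v and e is at most (pi - kappa)/2: the direction range of
the definition of E.  Rotating to the model position, E(rho) = 0 yields
    int_(C(rho e, v) & B_D) |xi|^beta >= int_(B_D \ B_R0) |xi|^beta > 0.
Translating C(rho e, v) by -(rho - r) e onto C(r e, v) shrinks all norms by a
factor gamma < 1 that depends only on b, rho and D ([shifted_cone_contracts]).
As k is decreasing in r and k/psi tends to r^beta uniformly on compact intervals
([kbar_power_uniform]), the mass of C(r e, v) & B_D is at least about
psi gamma^beta times the left integral, the mass of the annulus is at most about
psi times the right one, and gamma^beta > 1.

The zero rho is positive in the second case because r <= b rho; if E had no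
positive zero, the default value 0 of Rtilde would lead to the first case.

The invariance of Lebesgue measure under orthogonal maps rests on the classical
Fubini argument comparing two translation invariant measures
([translation_invariant_exchange]); reflections then move any two unit vectors
into the plane of the model cones ([orthogonal_pair_transport]). *)

(** * The Euclidean inner product and norm *)

Section dot_product.
Context {R : realType} {n : nat}.
Implicit Types (u v w x y : 'rV[R]_n) (a : R).

Lemma dotpC v w : dotp v w = dotp w v.
Proof. by apply: eq_bigr => i _; rewrite mulrC. Qed.

Lemma dotpDl u v w : dotp (u + v) w = dotp u w + dotp v w.
Proof. by rewrite /dotp -big_split; apply: eq_bigr => i _; rewrite mxE mulrDl. Qed.

Lemma dotpZl a v w : dotp (a *: v) w = a * dotp v w.
Proof. by rewrite /dotp mulr_sumr; apply: eq_bigr => i _; rewrite mxE mulrA. Qed.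

Lemma dotpNl v w : dotp (- v) w = - dotp v w.
Proof. by rewrite -scaleN1r dotpZl mulN1r. Qed.

Lemma dotp0l w : dotp 0 w = 0.
Proof. by rewrite -(scale0r 0) dotpZl mul0r. Qed.

Lemma dotpDr u v w : dotp u (v + w) = dotp u v + dotp u w.
Proof. by rewrite !(dotpC u) dotpDl. Qed.

Lemma dotpZr a v w : dotp v (a *: w) = a * dotp v w.
Proof. by rewrite !(dotpC v) dotpZl. Qed.

Lemma dotpNr v w : dotp v (- w) = - dotp v w.
Proof. by rewrite !(dotpC v) dotpNl. Qed.

Definition dotpE := (dotpDl, dotpDr, dotpNl, dotpNr, dotpZl, dotpZr).

Lemma dotp_ge0 v : 0 <= dotp v v.
Proof. by apply: sumr_ge0 => i _; rewrite -expr2 sqr_ge0. Qed.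

Lemma sqr_enorm v : enorm v ^+ 2 = dotp v v.
Proof. by rewrite sqr_sqrtr ?dotp_ge0. Qed.

Lemma enorm_ge0 v : 0 <= enorm v.
Proof. exact: sqrtr_ge0. Qed.

Lemma coord_le_enorm v i : `|v ord0 i| <= enorm v.
Proof.
rewrite -sqrtr_sqr ler_wsqrtr// /dotp (bigD1 i)//= -expr2 lerDl.
by apply: sumr_ge0 => j _; rewrite -expr2 sqr_ge0.
Qed.

Lemma enorm_eq0 v : (enorm v == 0) = (v == 0).
Proof.
apply/eqP/eqP => [v0|->]; last by rewrite /enorm dotp0l sqrtr0.
apply/rowP => i; rewrite mxE; apply/eqP; rewrite -normr_le0 -v0.
exact: coord_le_enorm.
Qed.

Lemma enorm0 : enorm (0 : 'rV[R]_n) = 0.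
Proof. by apply/eqP; rewrite enorm_eq0. Qed.

Lemma enorm_gt0 v : (0 < enorm v) = (v != 0).
Proof. by rewrite lt_def enorm_ge0 andbT enorm_eq0. Qed.

Lemma enormZ a v : enorm (a *: v) = `|a| * enorm v.
Proof.
by rewrite /enorm dotpZl dotpZr mulrA sqrtrM -?expr2 ?sqr_ge0// sqrtr_sqr.
Qed.

Lemma enormN v : enorm (- v) = enorm v.
Proof. by rewrite -scaleN1r enormZ normrN1 mul1r. Qed.

Lemma enorm_distC v w : enorm (v - w) = enorm (w - v).
Proof. by rewrite -opprB enormN. Qed.

Lemma dotp_enorm1 v : enorm v = 1 -> dotp v v = 1.
Proof. by move=> v1; rewrite -sqr_enorm v1 expr1n. Qed.

Lemma enorm_le_sqr v a : 0 <= a -> (enorm v <= a) = (dotp v v <= a ^+ 2).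
Proof. by move=> a0; rewrite -sqr_enorm ler_sqr ?nnegrE ?enorm_ge0. Qed.

(** The square of [dotp w w *: v - dotp v w *: w] is nonnegative. *)
Lemma CauchySchwarz_dotp v w : dotp v w <= enorm v * enorm w.
Proof.
have [->|w0] := eqVneq w 0; first by rewrite dotpC dotp0l enorm0 mulr0.
have ww : 0 < dotp w w by rewrite -sqr_enorm exprn_gt0// enorm_gt0.
have := dotp_ge0 (dotp w w *: v - dotp v w *: w).
rewrite !dotpE (dotpC w v).
rewrite (_ : _ + _ = dotp w w * (dotp v v * dotp w w - dotp v w ^+ 2)); last by ring.
rewrite pmulr_rge0// subr_ge0 -!sqr_enorm -exprMn => h.
apply: le_trans (ler_norm _) _.
by rewrite -ler_sqr ?nnegrE ?mulr_ge0 ?enorm_ge0// real_normK ?num_real.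
Qed.

Lemma ler_enormD v w : enorm (v + w) <= enorm v + enorm w.
Proof.
rewrite enorm_le_sqr ?addr_ge0 ?enorm_ge0// sqrrD !dotpE (dotpC w) !sqr_enorm.
have := CauchySchwarz_dotp v w; lra.
Qed.

Lemma enorm_normalize v : v != 0 -> enorm ((enorm v)^-1 *: v) = 1.
Proof.
by move=> v0; rewrite enormZ ger0_norm ?invr_ge0 ?enorm_ge0// mulVf// enorm_eq0.
Qed.

Lemma norm_le_enorm v : `|v| <= enorm v.
Proof.
rewrite [leLHS]/Num.norm /= mx_normrE; apply/bigmax_leP; split; first exact: enorm_ge0.
by move=> [i j] _ /=; rewrite (ord1 i) coord_le_enorm.
Qed.

End dot_product.

Section dot_product_continuous.
Context {R : realType} {n : nat} {T : topologicalType}.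
Implicit Types f g : T -> 'rV[R]_n.

Lemma dotp_continuous f g :
  continuous f -> continuous g -> continuous (fun x => dotp (f x) (g x)).
Proof.
move=> cf cg.
apply: (@continuous_big R 'I_n +%R 0 xpredT _ T (index_enum _)
  (fun i x => f x ord0 i * g x ord0 i)); first exact: add_continuous.
move=> i _ x; apply: cvgM.
  by apply: (@continuous_comp _ _ _ f (fun v => v ord0 i)); [exact: cf|exact: coord_continuous].
by apply: (@continuous_comp _ _ _ g (fun v => v ord0 i)); [exact: cg|exact: coord_continuous].
Qed.

Lemma enorm_continuous f : continuous f -> continuous (fun x => enorm (f x)).
Proof.
move=> cf x.
apply: (@continuous_comp _ _ _ (fun x => dotp (f x) (f x)) (@Num.sqrt R)).
  exact: dotp_continuous.
exact: sqrt_continuous.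
Qed.

Lemma subv_continuous f g :
  continuous f -> continuous g -> continuous (fun x => f x - g x).
Proof. by move=> cf cg x; apply: cvgB; [exact: cf|exact: cg]. Qed.

End dot_product_continuous.

(** * Borel sets and Borel functions on row vectors *)

Lemma preimage_measurable d d' (T : measurableType d) (U : measurableType d')
    (f : T -> U) (A : set U) :
  measurable_fun setT f -> measurable A -> measurable (f @^-1` A).
Proof. by move=> mf mA; rewrite -[X in measurable X]setTI; exact: mf. Qed.

Section measurable_row_vectors.
Context {R : realType} {n : nat}.

Lemma measurable_box (A : 'I_n -> set (measurableTypeR R)) :
  (forall i, measurable (A i)) ->
  measurable [set v : 'rV[R]_n | forall i, A i (rV_coord i v)].
Proof.
move=> mA; rewrite (_ : [set v | _] = \big[setI/setT]_(i < n) (rV_coord i @^-1` A i)).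
  apply: bigsetI_measurable => i _; apply: preimage_measurable => //.
  exact: measurable_rV_coord.
rewrite -bigcap_seq; apply/seteqP; split => v /= H i; last exact/H/mem_index_enum.
by move=> _; exact: H.
Qed.

(** The sigma-algebra is generated by the coordinates; an open set is the union of
the countably many boxes with rational centre and radius 1/(k+1) that it contains. *)
Lemma open_rV_measurable (U : set 'rV[R]_n) : open U -> measurable U.
Proof.
move=> oU.
pose box (p : 'rV[rat]_n * nat) : set 'rV[R]_n :=
  [set v | forall i, ball (ratr (p.1 ord0 i) : R) p.2.+1%:R^-1 (v ord0 i)].
pose F p := if `[< box p `<=` U >] then box p else set0.
rewrite (_ : U = \bigcup_p F p).
  apply: (@countable_bigcupT_measurable _ _ _ F) => [|p]; first exact: countableP.
  rewrite /F; case: ifP => [_|_]; last exact: measurable0.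
  apply: (measurable_box (A := fun i => ball (ratr (p.1 ord0 i) : R) p.2.+1%:R^-1)) => i.
  exact: measurable_ball.
rewrite /F; apply/seteqP; split => [x Ux|x [p _]]; last by case: asboolP => // h /h.
have /nbhs_ballP[e /= e0 eU] : nbhs x U by exact: open_nbhs_nbhs.
have [k ke] : exists k : nat, k.+1%:R^-1 < e / 2.
  have [k _ /(_ _ (leqnn k))] := near_infty_natSinv_lt (PosNum (divr_gt0 e0 (ltr0n R 2))).
  by exists k.
have q_ (i : 'I_n) : {q : rat | ball (x ord0 i) k.+1%:R^-1 (ratr q)}.
  apply: cid; have /= [q] : exists q : rat, ratr q \in `](x ord0 i), x ord0 i + k.+1%:R^-1[.
    by apply: rat_in_itvoo; rewrite ltrDl.
  have k0 : 0 < k.+1%:R^-1 :> R by rewrite invr_gt0.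
  by rewrite in_itv/= => /andP[h1 h2]; exists q;
    rewrite /ball/= ltr_distlC h2 andbT (lt_trans _ h1)// ltrBlDr ltrDl.
exists (\row_i sval (q_ i), k) => //; case: asboolP.
  by move=> _ i /=; rewrite mxE; apply: ball_sym; case: (q_ i).
move=> nU; exfalso; apply: nU => v /= bv; apply: eU; split => // i j.
rewrite (ord1 i); have := bv j; rewrite mxE => h.
have := svalP (q_ j) => h'.
apply: (@le_ball _ _ _ (k.+1%:R^-1 + k.+1%:R^-1)); first by rewrite [leRHS](splitr e) ltW// ltrD.
exact: ball_triangle h' h.
Qed.

Lemma closed_rV_measurable (A : set 'rV[R]_n) : closed A -> measurable A.
Proof.
move=> cA; rewrite -(setCK A); apply: measurableC.
by apply: open_rV_measurable; exact: closed_openC.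
Qed.

End measurable_row_vectors.

Section measurable_vector_functions.
Context d {T : measurableType d} {R : realType} {n : nat}.
Implicit Types f g : T -> 'rV[R]_n.

Lemma measurable_fun_dotp f g : measurable_fun setT f -> measurable_fun setT g ->
  measurable_fun setT (fun x => dotp (f x) (g x)).
Proof.
move=> mf mg; apply: measurable_sum => i; apply: measurable_funM.
  exact: (measurable_fun_rVP f).1.
exact: (measurable_fun_rVP g).1.
Qed.

Lemma measurable_fun_enorm f : measurable_fun setT f ->
  measurable_fun setT (fun x => enorm (f x)).
Proof.
move=> mf; apply: (@measurableT_comp _ _ _ _ _ _ (@Num.sqrt R)).
  by apply: continuous_measurable_fun; exact: sqrt_continuous.
exact: measurable_fun_dotp.
Qed.

Lemma measurable_fun_addv f g : measurable_fun setT f -> measurable_fun setT g ->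
  measurable_fun setT (fun x => f x + g x).
Proof.
move=> mf mg; apply/measurable_fun_rVP => i.
rewrite (_ : _ \o _ = (rV_coord i \o f) \+ (rV_coord i \o g)).
  apply: measurable_funD; exact: (measurable_fun_rVP _).1.
by apply/funext => x; rewrite /rV_coord /= mxE.
Qed.

Lemma measurable_fun_scalev (a : T -> R) f : measurable_fun setT a ->
  measurable_fun setT f -> measurable_fun setT (fun x => a x *: f x).
Proof.
move=> ma mf; apply/measurable_fun_rVP => i.
rewrite (_ : _ \o _ = a \* (rV_coord i \o f)).
  by apply: measurable_funM => //; exact: (measurable_fun_rVP _).1.
by apply/funext => x; rewrite /rV_coord /= mxE.
Qed.

Lemma measurable_fun_oppv f : measurable_fun setT f ->
  measurable_fun setT (fun x => - f x).
Proof.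
move=> mf; rewrite (_ : (fun x => - f x) = (fun x => cst (-1) x *: f x)).
  exact: measurable_fun_scalev.
by apply/funext => x; rewrite scaleN1r.
Qed.

End measurable_vector_functions.

Lemma measurable_cball {R : realType} {n : nat} (x : 'rV[R]_n) r :
  measurable (cball x r).
Proof.
apply: (@preimage_measurable _ _ _ _ (fun y : 'rV[R]_n => enorm (y - x)) `]-oo, r]) => //.
by apply: measurable_fun_enorm; exact: measurable_fun_addv.
Qed.

(** * Lebesgue measure: translations, balls and open sets *)

Definition pushforward_measure d d' (T : measurableType d) (U : measurableType d')
    (R : realFieldType) (mu : {measure set T -> \bar R}) (f : T -> U)
    (mf : measurable_fun setT f) : {measure set U -> \bar R} :=
  measure_function_pushforward__canonical__measure_function_Measure mu mf.

Lemma lebesgue_measure_translate {R : realType} (c : R) (A : set (measurableTypeR R)) :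
  measurable A ->
  lebesgue_measure ((fun x => x + c) @^-1` A : set (measurableTypeR R)) =
  lebesgue_measure A.
Proof.
move=> mA; have mf : measurable_fun setT (fun x : measurableTypeR R => x + c : measurableTypeR R).
  exact: measurable_funD.
apply/esym; apply: (lebesgue_measure_unique (mu := pushforward_measure lebesgue_measure mf)) => //.
move=> _ [[a b] _ <-] /=.
rewrite /pushforward /= (_ : _ @^-1` _ = `]a - c, b - c]%classic).
  rewrite !lebesgue_measure_itv/= !lte_fin ltrD2r; case: ifP => // _.
  by rewrite -!EFinD; congr EFin; ring.
by apply/seteqP; split => x /=; rewrite !in_itv/= ltrBlDr lerBrDr.
Qed.

(** Induction on the dimension: a translation of R^(n+1) acts separately on the first
coordinate and on the others, and a product measure is determined by its values on
rectangles. *)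
Lemma lebesgue_rV_translate {R : realType} n (c : 'rV[R]_n) (A : set 'rV[R]_n) :
  measurable A -> lebesgue_rV n ((fun x => x + c) @^-1` A) = lebesgue_rV n A.
Proof.
elim: n => [|n ih] in c A *.
  move=> mA /=; rewrite !diracE; congr ((nat_of_bool _)%:R%:E).
  apply/idP/idP; rewrite !inE /=; have -> : 0 + c = 0 by apply/rowP => -[].
    by [].
  by [].
move=> mA.
have mc (k : nat) (v : 'rV[R]_k) : measurable_fun setT (fun x : 'rV[R]_k => x + v).
  exact: measurable_fun_addv.
pose c' : 'rV[R]_n := \row_j c ord0 (lift ord0 j).
pose tr (p : measurableTypeR R * 'rV[R]_n) : measurableTypeR R * 'rV[R]_n :=
  (p.1 + c ord0 ord0, p.2 + c').
have mtr : measurable_fun setT tr.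
  apply/measurable_fun_pair.
    by apply: measurable_funD.
  exact: measurable_fun_addv.
have mtr1 : measurable_fun setT (fun x : measurableTypeR R => x + c ord0 ord0 : measurableTypeR R).
  exact: measurable_funD.
have trE p : rV_cons p + c = rV_cons (tr p).
  by apply/rowP => i; rewrite !mxE; case: unliftP => [j|] ->//=; rewrite !mxE.
rewrite /= /rV_cons_measure /pushforward -comp_preimage.
rewrite (_ : _ @^-1` A = tr @^-1` (@rV_cons R n @^-1` A)); last first.
  by apply/seteqP; split => p /=; rewrite trE.
apply/esym; apply: (product_measure_unique
  (m' := pushforward_measure (lebesgue_measure \x lebesgue_rV n)%E mtr)).
  move=> B C mB mC; rewrite /= /pushforward.
  rewrite (_ : _ @^-1` _ = ((fun x => x + c ord0 ord0) @^-1` B) `*` ((fun x => x + c') @^-1` C))//.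
  rewrite product_measure1E.
  - by rewrite [X in (X * _)%E]lebesgue_measure_translate// [X in (_ * X)%E]ih.
  - exact: (preimage_measurable mtr1).
  - exact: (preimage_measurable (mc _ c')).
by apply: (preimage_measurable (@measurable_rV_cons R n)).
Qed.

Section volumes.
Context {R : realType} {n : nat}.

Lemma sup_box_volume (x : 'rV[R]_n) r : 0 <= r ->
  lebesgue_rV n [set v | forall i, `[x ord0 i - r, x ord0 i + r]%classic (rV_coord i v)] =
  ((r + r) ^+ n)%:E.
Proof.
move=> r0; rewrite (lebesgue_rV_box (A := fun i => `[x ord0 i - r, x ord0 i + r]%classic))//.
rewrite (eq_bigr (fun=> (r + r)%:E)).
  by rewrite prodEFin big_const iter_mulr_1 card_ord.
move=> i _; rewrite lebesgue_measure_itv/= lte_fin.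
case: ifP => [_|]; first by rewrite -EFinD; congr EFin; ring.
move=> /negbT; rewrite -leNgt => h; congr EFin; lra.
Qed.

Lemma lebesgue_rV_cball_lty (x : 'rV[R]_n) r : (lebesgue_rV n (cball x r) < +oo)%E.
Proof.
have [r0|r0] := ltP r 0.
  rewrite (_ : cball x r = set0) ?measure0//.
  apply/seteqP; split => // y /= yr; have := enorm_ge0 (y - x); rewrite leNgt.
  by rewrite (le_lt_trans yr).
apply: (@le_lt_trans _ _ ((r + r) ^+ n)%:E); last exact: ltry.
rewrite -(sup_box_volume x r0); apply: le_measure; rewrite ?inE.
- exact: measurable_cball.
- exact: (measurable_box (A := fun i => `[x ord0 i - r, x ord0 i + r]%classic)).
move=> y /= yr i; rewrite in_itv/= /rV_coord; have := le_trans (coord_le_enorm _ i) yr.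
by rewrite !mxE ler_distl.
Qed.

Lemma lebesgue_rV_open_gt0 (U : set 'rV[R]_n) : open U -> U !=set0 ->
  (0 < lebesgue_rV n U)%E.
Proof.
move=> oU [x Ux].
have /nbhs_ballP[e /= e0 eU] : nbhs x U by exact: open_nbhs_nbhs.
have e20 : 0 < e / 2 by rewrite divr_gt0.
apply: (@lt_le_trans _ _ ((e / 2 + e / 2) ^+ n)%:E).
  by rewrite lte_fin exprn_gt0// -splitr.
rewrite -(sup_box_volume x (ltW e20)); apply: le_measure; rewrite ?inE.
- exact: (measurable_box (A := fun i => `[x ord0 i - e / 2, x ord0 i + e / 2]%classic)).
- exact: open_rV_measurable.
move=> y /= ye; apply: eU; split => // i j; rewrite (ord1 i).
have := ye j; rewrite in_itv/= /rV_coord -ler_distl => h.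
rewrite /ball/= distrC (le_lt_trans h)// ltr_pdivrMr// mulr_natr mulr2n ltrDl//.
Qed.

End volumes.

Lemma lebesgue_rV_set1 {R : realType} n (x : 'rV[R]_n.+1) :
  lebesgue_rV n.+1 [set x] = 0%E.
Proof.
rewrite (_ : [set x] = [set v | forall i, [set x ord0 i] (rV_coord i v)]).
  rewrite (lebesgue_rV_box (A := fun i => [set x ord0 i])).
    by rewrite big_ord_recl lebesgue_measure_set1 mul0e.
  by move=> i; exact: measurable_set1.
apply/seteqP; split => [v -> //|v /= h]; apply/rowP => i; exact: h.
Qed.

(** * Lebesgue measure: orthogonal transformations *)

(** The two iterated integrals of an indicator function agree, because both define a
measure that is the product measure on rectangles. *)
Lemma integral_xsectionE d1 d2 (T1 : measurableType d1) (T2 : measurableType d2)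
    (R : realType) (m1 : {sigma_finite_measure set T1 -> \bar R})
    (m2 : {sigma_finite_measure set T2 -> \bar R}) (E : set (T1 * T2)) :
  measurable E ->
  (\int[m1]_x m2 (xsection E x) = \int[m2]_y m1 (ysection E y))%E.
Proof.
move=> mE.
apply: (product_measure_unique (m' := (m1 \x^ m2)%E : {measure set _ -> \bar R})) => // A B mA mB.
exact: product_measure2E.
Qed.

Section translation_invariant_measures.
Context {R : realType} {n : nat}.
Variable mu : {sigma_finite_measure set 'rV[R]_n -> \bar R}.
Hypothesis mu_translate : forall c (A : set 'rV[R]_n), measurable A ->
  mu ((fun x => x + c) @^-1` A) = mu A.
Let lambda := lebesgue_rV n : {sigma_finite_measure set 'rV[R]_n -> \bar R}.

(** Both sides compute the mass, for the product of [mu] and [lambda], of the pairs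
(x, y) with x in A and x + y in B: integrating first in y gives the left-hand side;
integrating first in x, after replacing x by x - y, gives the right-hand side. *)
Lemma translation_invariant_exchange (A B : set 'rV[R]_n) :
  measurable A -> measurable B ->
  (mu A * lambda B = mu B * lambda (-%R @^-1` A))%E.
Proof.
move=> mA mB.
have madd : measurable_fun setT (fun p : 'rV[R]_n * 'rV[R]_n => p.1 + p.2).
  exact: measurable_fun_addv.
have msub : measurable_fun setT (fun p : 'rV[R]_n * 'rV[R]_n => p.1 - p.2).
  by apply: measurable_fun_addv => //; exact: measurable_fun_oppv.
have mN : measurable (-%R @^-1` A : set 'rV[R]_n).
  by apply: preimage_measurable => //; exact: measurable_fun_oppv.
(* F is the image of E under (x, y) |-> (x + y, y). *)
pose E := [set p : 'rV[R]_n * 'rV[R]_n | A p.1 /\ B (p.1 + p.2)].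
pose F := [set p : 'rV[R]_n * 'rV[R]_n | B p.1 /\ A (p.1 - p.2)].
have mE : measurable E.
  by apply: measurableI; [exact: (preimage_measurable measurable_fst)|exact: (preimage_measurable madd)].
have mF : measurable F.
  by apply: measurableI; [exact: (preimage_measurable measurable_fst)|exact: (preimage_measurable msub)].
transitivity (\int[mu]_x lambda (xsection E x))%E.
  rewrite muleC -[X in (_ * mu X)%E]setIT -integral_indic//.
  rewrite -ge0_integralZl//; last by apply/measurable_EFinP; exact: measurable_indic.
  apply: eq_integral => x _; rewrite indicE.
  have [xA|xA] := boolP (x \in A).
    rewrite mule1 -(lebesgue_rV_translate x mB); congr (lambda _).
    apply/seteqP; split => y; rewrite /xsection/= inE /E/= addrC.
      by move=> ?; split => //; rewrite inE in xA.
    by case.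
  rewrite mule0 (_ : xsection E x = set0) ?measure0//.
  apply/seteqP; split => // y; rewrite /xsection/= inE /E/= => -[h _].
  by rewrite notin_setE in xA.
rewrite integral_xsectionE//.
transitivity (\int[lambda]_y mu (ysection F y))%E.
  apply: eq_integral => y _.
  rewrite -(mu_translate y (measurable_ysection y mF)); congr (mu _).
  apply/seteqP; split => x; rewrite /ysection/= !inE /E/F/= addrK; tauto.
rewrite -integral_xsectionE// muleC -[X in (_ * mu X)%E]setIT -integral_indic//.
rewrite -ge0_integralZl//; last by apply/measurable_EFinP; exact: measurable_indic.
apply: eq_integral => x _; rewrite indicE.
have [xB|xB] := boolP (x \in B).
  rewrite mule1 -(lebesgue_rV_translate (- x) mN); congr (lambda _).
  apply/seteqP; split => y; rewrite /xsection/= inE /F/= opprB; first by case.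
  by move=> ?; split => //; rewrite inE in xB.
rewrite mule0 (_ : xsection F x = set0) ?measure0//.
apply/seteqP; split => // y; rewrite /xsection/= inE /F/= => -[h _].
by rewrite notin_setE in xB.
Qed.

End translation_invariant_measures.

Section orthogonal_matrices.
Context {R : realType} {n : nat}.
Implicit Types (Q : 'M[R]_n) (v w x y : 'rV[R]_n).

Definition orthogonal_mx Q := Q *m Q^T = 1%:M.

Lemma dotp_mulmx v w : dotp v w = (v *m w^T) ord0 ord0.
Proof. by rewrite mxE; apply: eq_bigr => i _; rewrite mxE. Qed.

Lemma dotp_orthogonal Q v w : orthogonal_mx Q -> dotp (v *m Q) (w *m Q) = dotp v w.
Proof.
by move=> oQ; rewrite !dotp_mulmx trmx_mul mulmxA -(mulmxA v) oQ mulmx1.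
Qed.

Lemma enorm_orthogonal Q v : orthogonal_mx Q -> enorm (v *m Q) = enorm v.
Proof. by move=> oQ; rewrite /enorm dotp_orthogonal. Qed.

Lemma orthogonal_mulmx Q P : orthogonal_mx Q -> orthogonal_mx P -> orthogonal_mx (Q *m P).
Proof.
by rewrite /orthogonal_mx => oQ oP; rewrite trmx_mul mulmxA -(mulmxA Q) oP mulmx1.
Qed.

Lemma measurable_fun_mulmxr Q : measurable_fun setT (mulmxr Q : 'rV[R]_n -> 'rV[R]_n).
Proof.
apply/measurable_fun_rVP => i.
rewrite (_ : _ \o _ = fun x => \sum_j rV_coord j x * Q j i).
  by apply: measurable_sum => j; apply: measurable_funM => //; exact: measurable_rV_coord.
by apply/funext => x; rewrite /rV_coord /= mxE.
Qed.

(** The image of Lebesgue measure under [Q] is translation invariant, so the exchange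
identity applies to it and to Lebesgue measure itself.  Taking for B the unit ball,
whose volume is finite, positive and unchanged by [Q], shows that the two agree. *)
Lemma lebesgue_rV_orthogonal Q (A : set 'rV[R]_n) : orthogonal_mx Q -> measurable A ->
  lebesgue_rV n ((fun x => x *m Q) @^-1` A) = lebesgue_rV n A.
Proof.
move=> oQ mA.
pose mu0 := pushforward_measure (lebesgue_rV n) (measurable_fun_mulmxr Q).
have mu0_cball r : mu0 (cball 0 r) = lebesgue_rV n (cball 0 r).
  rewrite /mu0/= /pushforward; congr (lebesgue_rV n _).
  by apply/seteqP; split => x; rewrite /cball/= !subr0 enorm_orthogonal.
have sfin : sigma_finite setT mu0.
  exists (fun i : nat => cball 0 i%:R).
    apply/seteqP; split => // x _; exists (Num.bound (enorm x)) => //.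
    by rewrite /cball/= subr0 ltW// archi_boundP// enorm_ge0.
  move=> i; split; first exact: measurable_cball.
  by rewrite mu0_cball; exact: lebesgue_rV_cball_lty.
pose sf := Measure_isSigmaFinite.Build _ _ _ mu0 sfin.
pose mu : {sigma_finite_measure set 'rV[R]_n -> \bar R} := HB.pack_for
  {sigma_finite_measure set 'rV[R]_n -> \bar R} (Measure.sort mu0) mu0 sf.
have mu_tr c (B : set 'rV[R]_n) : measurable B -> mu ((fun x => x + c) @^-1` B) = mu B.
  move=> mB; rewrite /mu/= /pushforward.
  have mQB : measurable ((fun x => x *m Q) @^-1` B : set 'rV[R]_n).
    exact: (preimage_measurable (measurable_fun_mulmxr Q)).
  rewrite -[RHS](lebesgue_rV_translate (c *m Q^T) mQB); congr (lebesgue_rV n _).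
  apply/seteqP; split => x /=; rewrite mulmxDl -mulmxA.
    by rewrite (mulmx1C oQ) mulmx1.
  by rewrite (mulmx1C oQ) mulmx1.
have mB : measurable (cball (0 : 'rV[R]_n) 1) by exact: measurable_cball.
have h1 := translation_invariant_exchange mu_tr mA mB.
have h2 := translation_invariant_exchange (@lebesgue_rV_translate R n) mA mB.
have B0 : (0 < lebesgue_rV n (cball (0 : 'rV[R]_n) 1))%E.
  have oU : open [set x : 'rV[R]_n | enorm x < 1].
    apply: (@open_comp _ _ (fun x : 'rV[R]_n => enorm x) [set y : R | y < 1]); last exact: open_lt.
    by move=> x _; apply: (@enorm_continuous _ _ _ id) => y; exact: cvg_id.
  have U0 : (0 < lebesgue_rV n [set x : 'rV[R]_n | (enorm x < 1)%R])%E.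
    by apply: lebesgue_rV_open_gt0 => //; exists 0; rewrite /= enorm0.
  apply: (lt_le_trans U0); apply: le_measure; rewrite ?inE//.
    exact: open_rV_measurable.
  by move=> x /= x1; rewrite /cball/= subr0 ltW.
have Bfin : lebesgue_rV n (cball (0 : 'rV[R]_n) 1) \is a fin_num.
  by rewrite ge0_fin_numE ?measure_ge0//; exact: lebesgue_rV_cball_lty.
have eqA : (mu A * lebesgue_rV n (cball (0 : 'rV[R]_n) 1) =
    lebesgue_rV n A * lebesgue_rV n (cball (0 : 'rV[R]_n) 1))%E.
  by rewrite h1 h2; congr (_ * _)%E; exact: mu0_cball.
change (mu A = lebesgue_rV n A).
by apply/le_anti/andP; split; rewrite -(lee_pmul2r Bfin B0) eqA.
Qed.

Lemma ge0_integral_orthogonal Q (A : set 'rV[R]_n) (f : 'rV[R]_n -> \bar R) :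
  orthogonal_mx Q -> measurable A -> measurable_fun A f ->
  (forall x, A x -> 0 <= f x)%E ->
  (\int[lebesgue_rV n]_(x in A) f x =
   \int[lebesgue_rV n]_(x in (fun x => x *m Q) @^-1` A) f (x *m Q))%E.
Proof.
move=> oQ mA mf f0.
rewrite -(ge0_integral_pushforward (measurable_fun_mulmxr Q))//; last first.
  by move=> x; rewrite inE; exact: f0.
apply: (@eq_measure_integral _ _ _ _ (pushforward_measure (lebesgue_rV n) (measurable_fun_mulmxr Q))) => B mB _.
by rewrite /= /pushforward lebesgue_rV_orthogonal.
Qed.

Lemma ge0_integral_translate (c : 'rV[R]_n) (A : set 'rV[R]_n) (f : 'rV[R]_n -> \bar R) :
  measurable A -> measurable_fun A f -> (forall x, A x -> 0 <= f x)%E ->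
  (\int[lebesgue_rV n]_(x in A) f x =
   \int[lebesgue_rV n]_(x in (fun x => x + c)%R @^-1` A) f (x + c)%R)%E.
Proof.
move=> mA mf f0.
have mc : measurable_fun setT (fun x : 'rV[R]_n => x + c) by exact: measurable_fun_addv.
rewrite -(ge0_integral_pushforward mc)//; last first.
  by move=> x; rewrite inE; exact: f0.
apply: (@eq_measure_integral _ _ _ _ (pushforward_measure (lebesgue_rV n) mc)) => B mB _.
by rewrite /= /pushforward lebesgue_rV_translate.
Qed.

Definition householder w : 'M[R]_n := 1%:M - (2 / dotp w w) *: (w^T *m w).

Lemma mulmx_householder x w : x *m householder w = x - (2 * dotp x w / dotp w w) *: w.
Proof.
rewrite mulmxBr mulmx1 -scalemxAr mulmxA; congr (_ - _).
rewrite [x *m w^T]mx11_scalar -dotp_mulmx mul_scalar_mx scalerA; congr (_ *: _); ring.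
Qed.

Lemma orthogonal_householder w : orthogonal_mx (householder w).
Proof.
have sym : (householder w)^T = householder w.
  by rewrite /householder linearB/= linearZ/= trmx1 trmx_mul trmxK.
rewrite /orthogonal_mx sym; apply/row_matrixP => i; rewrite !rowE mulmxA mulmx1.
rewrite !mulmx_householder dotpDl dotpNl dotpZl.
have [w0|w0] := eqVneq (dotp w w) 0.
  by rewrite w0 invr0 !mulr0 !scale0r !subr0.
rewrite mulfVK//; apply/rowP => j; rewrite !mxE.
set a := dotp _ _; set b := dotp _ _ in w0 *; by field.
Qed.

(** Two vectors of equal norm are mirror images across the hyperplane orthogonal to
their difference. *)
Lemma householder_exchange v w : enorm v = enorm w -> v *m householder (v - w) = w.
Proof.
move=> vw; have [->|d0] := eqVneq v w.
  by rewrite subrr mulmx_householder scaler0 subr0.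
have dd : dotp (v - w) (v - w) != 0.
  by rewrite -sqr_enorm expf_neq0// enorm_eq0 subr_eq0.
rewrite mulmx_householder (_ : 2 * dotp v (v - w) = dotp (v - w) (v - w)).
  by rewrite divff// scale1r subKr.
rewrite !dotpE (dotpC w v) -!sqr_enorm vw; ring.
Qed.

Lemma householder_fix x w : dotp x w = 0 -> x *m householder w = x.
Proof. by move=> xw; rewrite mulmx_householder xw mulr0 mul0r scale0r subr0. Qed.

(** A first reflection carries e to e'.  The second one carries the image of v to v';
its normal is orthogonal to e', because both vectors have the same product with e',
and so it leaves e' in place. *)
Lemma orthogonal_pair_transport (e v e' v' : 'rV[R]_n) :
  enorm e = enorm e' -> enorm v = enorm v' -> dotp e v = dotp e' v' ->
  exists Q, [/\ orthogonal_mx Q, e *m Q = e' & v *m Q = v'].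
Proof.
move=> ee vv ev.
have oP := orthogonal_householder (e - e').
have eP := householder_exchange ee.
move: (householder _) oP eP => P oP eP.
have vP : enorm (v *m P) = enorm v' by rewrite enorm_orthogonal.
have oH := orthogonal_householder (v *m P - v').
have vH := householder_exchange vP.
have eH : e' *m householder (v *m P - v') = e'.
  by apply: householder_fix; rewrite dotpDr dotpNr -{1}eP (dotp_orthogonal _ _ oP) ev subrr.
exists (P *m householder (v *m P - v')).
by split; [exact: orthogonal_mulmx|rewrite mulmxA eP|rewrite mulmxA vH].
Qed.

End orthogonal_matrices.

(** * Cones *)

Lemma ereal_gt0_real {R : realType} (delta : \bar R) : (0 < delta)%E ->
  exists2 d : R, 0 < d & (d%:E < delta)%E.
Proof.
case: delta => [r|_|]//; last by exists 1 => //; rewrite ltry.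
by rewrite lte_fin => r0; exists (r / 2);
  rewrite ?lte_fin ?divr_gt0// ltr_pdivrMr// mulr_natr mulr2n ltrDl.
Qed.

Section cones.
Context {R : realType} {n : nat}.
Implicit Types (p q v w x y z e : 'rV[R]_n) (kappa : R) (delta : \bar R).

(** This form is homogeneous in z - x.  The strict inequality excludes the vertex. *)
Lemma open_coneP x v kappa delta z : open_cone x v kappa delta z <->
  ((enorm (z - x))%:E < delta)%E /\ cos (kappa / 2) * enorm (z - x) < dotp (z - x) v.
Proof.
split=> [[rho [w [rho0 rhod w1 wv ->]]]|[zd zv]].
  rewrite addrAC subrr add0r enormZ w1 mulr1 gtr0_norm//; split => //.
  by rewrite dotpZl mulrC ltr_pM2l.
have zx : z - x != 0.
  by apply: contraTneq zv => ->; rewrite enorm0 dotp0l mulr0 ltxx.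
have zx0 : 0 < enorm (z - x) by rewrite enorm_gt0.
exists (enorm (z - x)), ((enorm (z - x))^-1 *: (z - x)); split => //.
- exact: enorm_normalize.
- by rewrite dotpZl -ltr_pdivrMl ?invr_gt0// invrK mulrC.
- by rewrite scalerA divff ?gt_eqF// scale1r addrC subrK.
Qed.

Lemma open_cone_orthogonal (Q : 'M[R]_n) x v kappa delta z : orthogonal_mx Q ->
  open_cone (x *m Q) (v *m Q) kappa delta (z *m Q) <-> open_cone x v kappa delta z.
Proof.
move=> oQ; split => /open_coneP[h1 h2]; apply/open_coneP; move: h1 h2;
  by rewrite -mulmxBl enorm_orthogonal// dotp_orthogonal.
Qed.

Lemma open_cone_translate c x v kappa delta z :
  open_cone (x + c) v kappa delta (z + c) <-> open_cone x v kappa delta z.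
Proof.
have E : z + c - (x + c) = z - x by rewrite opprD addrACA subrr addr0.
by split => /open_coneP[h1 h2]; apply/open_coneP; move: h1 h2; rewrite E.
Qed.

Lemma open_EFin_lt (T : topologicalType) (f : T -> R) delta : continuous f ->
  open [set t | ((f t)%:E < delta)%E].
Proof.
move=> cf; case: delta => [r||].
- rewrite (_ : [set _ | _] = f @^-1` [set y : R | y < r]).
    by apply: open_comp; [move=> t _; exact: cf|exact: open_lt].
  by apply/seteqP; split => t /=; rewrite lte_fin.
- rewrite (_ : [set _ | _] = setT); first exact: openT.
  by apply/seteqP; split => t //= _; rewrite ltry.
- rewrite (_ : [set _ | _] = set0); first exact: open0.
  by apply/seteqP; split => t //=.
Qed.

(** Membership in a cone is an open condition jointly in the point, the vertex and the
axis: a limit of cones avoiding a set still avoids it. *)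
Lemma open_cone_incidence (T : topologicalType) (f g h : T -> 'rV[R]_n) kappa delta :
  continuous f -> continuous g -> continuous h ->
  open [set t | open_cone (f t) (g t) kappa delta (h t)].
Proof.
move=> cf cg ch.
have cd : continuous (fun t => h t - f t) by exact: subv_continuous.
rewrite (_ : [set _ | _] = [set t | ((enorm (h t - f t))%:E < delta)%E] `&`
   [set t | 0 < dotp (h t - f t) (g t) - cos (kappa / 2) * enorm (h t - f t)]).
  apply: openI; first by apply: open_EFin_lt; exact: enorm_continuous.
  have cF : continuous (fun t => dotp (h t - f t) (g t) - cos (kappa / 2) * enorm (h t - f t)).
    move=> t; apply: cvgB; first exact: (dotp_continuous cd cg).
    by apply: cvgM; [exact: cvg_cst|exact: (enorm_continuous cd)].
  apply: (@open_comp _ _ (fun t => dotp (h t - f t) (g t) - cos (kappa / 2) * enorm (h t - f t))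
    [set y : R | 0 < y]); last exact: open_gt.
  by move=> t _; exact: cF.
apply/seteqP; split => t /=; rewrite open_coneP subr_gt0 //.
Qed.

Lemma open_open_cone x v kappa delta : open (open_cone x v kappa delta).
Proof.
apply: (@open_cone_incidence _ (cst x) (cst v) id).
- exact: cst_continuous.
- exact: cst_continuous.
- by move=> z; exact: cvg_id.
Qed.

Lemma measurable_open_cone x v kappa delta : measurable (open_cone x v kappa delta).
Proof. by apply: open_rV_measurable; exact: open_open_cone. Qed.

Lemma cball_compact x r : compact (cball x r).
Proof.
apply: bounded_closed_compact.
  exists (enorm x + r); split; first by rewrite num_real.
  move=> M rM y /= yr; apply: (le_trans (norm_le_enorm y)); apply: ltW.
  apply: le_lt_trans rM; rewrite -(subrK x y) (le_trans (ler_enormD _ _))// addrC lerD2l.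
  exact: yr.
have cd : continuous (fun y : 'rV[R]_n => y - x).
  apply: (@subv_continuous _ _ _ id (cst x)); last exact: cst_continuous.
  by move=> y; exact: cvg_id.
apply: (@closed_comp _ _ (fun y => enorm (y - x)) [set s : R | s <= r]); last exact: closed_le.
by move=> y _; exact: (enorm_continuous cd).
Qed.

(** The pairs (p, v) such that the cone at p of axis v lies in [A] form a closed set,
even if [A] is not closed, since each condition that z belong to the cone is open in
(p, v).  With v on the unit sphere and p in a ball around y the set is compact, and
the distance to y attains its minimum.  The vertex p may lie on the boundary of [A]. *)
Lemma closest_cone (A : set 'rV[R]_n) kappa delta y : A !=set0 ->
  (forall x, A x -> exists2 v, enorm v = 1 & open_cone x v kappa delta `<=` A) ->
  exists p v, [/\ enorm v = 1, open_cone p v kappa delta `<=` A &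
    forall x, A x -> enorm (p - y) <= enorm (x - y)].
Proof.
move=> [a Aa] coneA.
pose S := [set pv : 'rV[R]_n * 'rV[R]_n | open_cone pv.1 pv.2 kappa delta `<=` A].
pose N := [set pv : 'rV[R]_n * 'rV[R]_n | enorm pv.2 = 1].
have cfst : continuous (@fst 'rV[R]_n 'rV[R]_n) by move=> pv; exact: cvg_fst.
have csnd : continuous (@snd 'rV[R]_n 'rV[R]_n) by move=> pv; exact: cvg_snd.
have closedS : closed S.
  rewrite -[S]setCK; apply: open_closedC.
  rewrite (_ : ~` S = \bigcup_(z in ~` A) [set pv | open_cone pv.1 pv.2 kappa delta z]).
    apply: bigcup_open => z _; apply: open_cone_incidence.
    - exact: cfst.
    - exact: csnd.
    - exact: cst_continuous.
  apply/seteqP; split => [pv /existsNP[z /not_implyP[zc zA]]|pv [z zA zc] /(_ z zc)]//.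
  by exists z.
have closedN : closed N.
  apply: (@closed_comp _ _ (fun pv : 'rV[R]_n * 'rV[R]_n => enorm pv.2)
    [set s : R | s = 1]); last exact: closed_eq.
  by move=> pv _; exact: (enorm_continuous csnd).
have cd : continuous (fun pv : 'rV[R]_n * 'rV[R]_n => pv.1 - y).
  by apply: (@subv_continuous _ _ _ fst (cst y)); [exact: cfst|exact: cst_continuous].
pose r := enorm (a - y).
have cK : compact ((cball y r `*` cball (0 : 'rV[R]_n) 1) `&` (S `&` N)).
  apply: compact_closedI; last exact: closedI.
  by apply: compact_setX; exact: cball_compact.
have [v v1 va] := coneA _ Aa.
have [||pv pvK minpv] := @compact_EVT_min _ R (fun pv : 'rV[R]_n * 'rV[R]_n => enorm (pv.1 - y)) _ _ cK.
- by exists (a, v); split; [split; rewrite /cball/= ?subr0 ?v1|split].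
- by apply: continuous_subspaceT; exact: (enorm_continuous cd).
move: pvK; rewrite inE => -[[/= pr _] [Sp Np]].
exists pv.1, pv.2; split => // x Ax.
have [xr|xr] := leP (enorm (x - y)) r; last exact: le_trans pr (ltW xr).
have [w w1 xw] := coneA _ Ax.
apply: (minpv (x, w)); rewrite inE.
by split; [split; rewrite /cball/= ?subr0 ?w1|split].
Qed.

(** A direction with negative product against p - y would, followed for a short time
from p, come closer to y than p. *)
Lemma cone_outside_ball_dir p v y kappa delta w : (0 < delta)%E ->
  (forall z, open_cone p v kappa delta z -> enorm (p - y) <= enorm (z - y)) ->
  cos (kappa / 2) * enorm w < dotp w v -> 0 <= dotp w (p - y).
Proof.
move=> delta0 out wv; rewrite leNgt; apply/negP => wq.
have [d d0 dd] := ereal_gt0_real delta0.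
have w0 : 0 < enorm w.
  by rewrite enorm_gt0; apply: contraTneq wq => ->; rewrite dotp0l ltxx.
(* The first bound keeps p + s w within the height of the cone; the second one is half
   of the time at which |p - y + s w| is back to |p - y|. *)
pose s := Num.min (d / enorm w) (- dotp w (p - y) / enorm w ^+ 2).
have s0 : 0 < s.
  by rewrite lt_min !divr_gt0// ?exprn_gt0// oppr_gt0.
have sd : s * enorm w <= d by rewrite -ler_pdivlMr// ge_min lexx.
have sq : s * enorm w ^+ 2 <= - dotp w (p - y).
  by rewrite -ler_pdivlMr ?exprn_gt0// ge_min lexx orbT.
have pz : p + s *: w - p = s *: w by rewrite addrAC subrr add0r.
have /out : open_cone p v kappa delta (p + s *: w).
  apply/open_coneP; rewrite pz enormZ gtr0_norm//; split.
    by rewrite (le_lt_trans _ dd)// lee_fin.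
  by rewrite dotpZl mulrCA ltr_pM2l.
rewrite addrAC enorm_le_sqr ?enorm_ge0// sqr_enorm.
move: (p - y) wq s s0 sd sq {pz} => q wq s s0 sd sq.
rewrite !dotpE (dotpC q w) -(sqr_enorm w).
have := ltr_pM2l s0 (dotp w q) 0; rewrite wq mulr0.
have := ler_pM2l s0 (s * enorm w ^+ 2) (- dotp w q); rewrite sq.
set u := dotp w _; set W := enorm w ^+ 2; set P := dotp _ _.
move=> h1 h2 h3; have : s * (s * W) <= s * (- u) by rewrite h1.
have : s * u < 0 by rewrite h2.
nra.
Qed.

(** The extreme case for the angle bound: if the product c of v and e were smaller than
sin(kappa/2), then v - c e would lie inside the cone of directions, and so would
v - (c + eps) e, whose product with e is -eps. *)
Lemma cone_dual_dir v e kappa : enorm v = 1 -> enorm e = 1 -> 0 < kappa -> kappa <= pi ->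
  (forall w, cos (kappa / 2) * enorm w < dotp w v -> 0 <= dotp w e) ->
  sin (kappa / 2) <= dotp v e.
Proof.
move=> v1 e1 kappa0 kappapi dual.
have pi0 := pi_gt0 R.
set g := cos (kappa / 2) in dual *.
have g0 : 0 <= g by apply: cos_ge0_pihalf; apply/andP; split; lra.
have s0 : 0 < sin (kappa / 2) by apply: sin_gt0_pi; apply/andP; split; lra.
have gs : g ^+ 2 + sin (kappa / 2) ^+ 2 = 1 by rewrite cos2Dsin2.
have g1 : g < 1 by nra.
set c := dotp v e.
have c0 : 0 <= c by apply: dual; rewrite v1 dotp_enorm1// mulr1.
have c1 : c <= 1 by have := CauchySchwarz_dotp v e; rewrite v1 e1 mulr1.
rewrite leNgt; apply/negP => cs.
pose S := 1 - c ^+ 2.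
have Sg : g ^+ 2 < S by rewrite /S; nra.
have S1 : S <= 1 by rewrite /S; nra.
have S0 : 0 < S by nra.
(* Inside the cone of directions means g^2 (S + eps^2) < (S - eps c)^2, whose
   defect at eps = 0 is S (S - g^2) > 0; a quarter of it absorbs the error. *)
pose eps := S * (S - g ^+ 2) / 4.
have eps0 : 0 < eps by rewrite /eps divr_gt0// mulr_gt0// subr_gt0.
have epsS : eps * 4 = S * (S - g ^+ 2) by rewrite /eps mulfVK.
have := dual (v - (c + eps) *: e); rewrite !dotpE dotp_enorm1// dotp_enorm1// -/c mulr1.
have -> : dotp e v = c by rewrite dotpC.
move=> h; have : 0 <= c - (c + eps); last by lra.
apply: h.
have nw : enorm (v - (c + eps) *: e) ^+ 2 = S + eps ^+ 2.
  rewrite sqr_enorm !dotpE !dotp_enorm1// (dotpC e v) -/c /S; ring.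
have W0 := enorm_ge0 (v - (c + eps) *: e).
set W := enorm _ in nw W0 *.
rewrite (_ : 1 - _ = S - eps * c); last by rewrite /S; ring.
have epsle : eps * 4 <= S by rewrite epsS; nra.
have r0 : 0 <= S - eps * c by nra.
rewrite -ltr_sqr ?nnegrE ?mulr_ge0// exprMn nw.
have : g ^+ 2 <= 1 by nra.
have : 0 <= g ^+ 2 by exact: sqr_ge0.
move: Sg epsS; set G := g ^+ 2 => Sg epsS G0 G1.
have : 2 * S * (eps * c) <= 2 * S * eps by nra.
have : S * eps <= eps by nra.
have : eps ^+ 2 * G <= eps by nra.
nra.
Qed.

End cones.

(** * The Riesz density on model cones *)

Lemma ler_powR_neg {R : realType} (a r s : R) : a <= 0 -> 0 < r -> r <= s ->
  s `^ a <= r `^ a.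
Proof.
move=> a0 r0 rs; rewrite -(opprK a) !(powRN _ (- a)).
rewrite lef_pV2 ?posrE ?powR_gt0 ?(lt_le_trans r0)//.
by apply: ge0_ler_powR; rewrite ?nnegrE ?oppr_ge0// ltW// (lt_le_trans r0).
Qed.

Lemma ge0_integral_le_cst d (T : measurableType d) (R : realType)
    (mu : {measure set T -> \bar R}) (A : set T) (f : T -> \bar R) (c : R) :
  measurable A -> measurable_fun A f -> (forall x, A x -> 0 <= f x)%E ->
  (forall x, A x -> f x <= c%:E)%E -> (\int[mu]_(x in A) f x <= c%:E * mu A)%E.
Proof.
move=> mA mf f0 fc; rewrite -integral_cst//.
by apply: ge0_le_integral => // x Ax; rewrite (le_trans (f0 x Ax))// fc.
Qed.

Section riesz_potential.
Context {R : realType} {m : nat}.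
Implicit Types (e v xi : 'rV[R]_m).
Notation basis := (@Defs.basis R m).

Lemma dotp_basis i j : (i < m)%N -> dotp (basis i) (basis j) = (i == j)%:R.
Proof.
move=> im; rewrite /dotp (bigD1 (Ordinal im))//= big1 => [|k].
  by rewrite !mxE/= eqxx mul1r addr0.
by rewrite -val_eqE/= => /negbTE ki; rewrite !mxE ki mul0r.
Qed.

(** The bound on the product of v and e says that their angle theta is at most
(pi - kappa)/2; an orthogonal map then brings e and v to the model position. *)
Lemma planar_direction e v kappa : (2 <= m)%N -> enorm e = 1 -> enorm v = 1 ->
  0 < kappa -> kappa <= pi -> sin (kappa / 2) <= dotp v e ->
  exists theta (Q : 'M[R]_m), [/\ 0 <= theta <= (pi - kappa) / 2, orthogonal_mx Q,
    e *m Q = basis 0 & v *m Q = cos theta *: basis 0 + sin theta *: basis m.-1].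
Proof.
move=> m2 e1 v1 kappa0 kappapi ve.
have pi0 := pi_gt0 R.
have s0 : 0 < sin (kappa / 2) by apply: sin_gt0_pi; apply/andP; split; lra.
have c1 : dotp v e <= 1 by have := CauchySchwarz_dotp v e; rewrite v1 e1 mulr1.
have cI : -1 <= dotp v e <= 1 by apply/andP; split => //; lra.
have b00 : dotp (basis 0) (basis 0) = 1 by rewrite dotp_basis ?(ltn_trans _ m2).
have bmm : dotp (basis m.-1) (basis m.-1) = 1 :> R.
  by rewrite dotp_basis ?eqxx// ltn_predL (ltn_trans _ m2).
have b0m : dotp (basis 0) (basis m.-1) = 0.
  rewrite dotp_basis ?(ltn_trans _ m2)// eq_sym (_ : _ == _ = false)//.
  by case: m m2 => [|[]].
pose theta := acos (dotp v e).
have ct : cos theta = dotp v e by rewrite acosK// in_itv.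
have theta0 : 0 <= theta by exact: acos_ge0.
exists theta.
have [|||Q [oQ eQ vQ]] := @orthogonal_pair_transport R m e v (basis 0)
  (cos theta *: basis 0 + sin theta *: basis m.-1).
- by rewrite e1 /enorm b00 sqrtr1.
- rewrite v1 /enorm !dotpE b00 bmm (dotpC (basis m.-1)) b0m.
  by rewrite !mulr0 addr0 add0r !mulr1 -!expr2 cos2Dsin2 sqrtr1.
- by rewrite dotpC !dotpE b00 b0m mulr1 mulr0 addr0 ct.
exists Q; split => //; rewrite theta0/=.
rewrite leNgt; apply/negP => ltt.
have := acos_lepi cI; rewrite -/theta => thetapi.
have : cos theta < cos ((pi - kappa) / 2).
  rewrite ltr_cos// in_itv/=; apply/andP; split => //; lra.
rewrite ct (_ : (pi - kappa) / 2 = pi / 2 - kappa / 2); last by lra.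
by rewrite -cosN opprB cosBpihalf ltNge ve.
Qed.

Variable beta : R.
Hypothesis beta_le0 : beta <= 0.
Notation riesz := (fun xi : 'rV[R]_m => (enorm xi `^ beta)%:E).

Lemma measurable_riesz (A : set 'rV[R]_m) : measurable_fun A riesz.
Proof.
apply: (@measurable_funS _ _ _ _ setT) => //.
apply/measurable_EFinP.
apply: (measurableT_comp (measurable_powR beta)).
exact: measurable_fun_enorm.
Qed.

(** Finiteness matters because the real-valued integral is 0 when the integral
diverges. *)
Lemma riesz_annulus_lty (r D : R) : 0 < r ->
  (\int[lebesgue_rV m]_(xi in cball 0 D `\` cball 0 r) riesz xi < +oo)%E.
Proof.
move=> r0.
apply: (@le_lt_trans _ _ ((r `^ beta)%:E * lebesgue_rV m (cball 0 D `\` cball 0 r))%E).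
  apply: ge0_integral_le_cst.
  - by apply: measurableD; exact: measurable_cball.
  - exact: measurable_riesz.
  - by move=> xi _; rewrite lee_fin powR_ge0.
  - move=> xi [_]; rewrite /cball/= subr0 => /negP; rewrite -ltNge => rxi.
    by rewrite lee_fin ler_powR_neg// ltW.
apply: lte_mul_pinfty; [by rewrite lee_fin powR_ge0|by []|].
apply: (@le_lt_trans _ _ (lebesgue_rV m (cball 0 D))); last exact: lebesgue_rV_cball_lty.
apply: le_measure; rewrite ?inE.
- by apply: measurableD; exact: measurable_cball.
- exact: measurable_cball.
- exact: subDsetl.
Qed.

Lemma riesz_annulus_gt0 (r D : R) : (0 < m)%N -> 0 < r -> r < D ->
  (0 < \int[lebesgue_rV m]_(xi in cball 0 D `\` cball 0 r) riesz xi)%E.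
Proof.
move=> m0 r0 rD; have D0 := lt_trans r0 rD.
pose U := [set xi : 'rV[R]_m | r < enorm xi] `&` [set xi : 'rV[R]_m | enorm xi < D].
have oU : open U.
  have ce : continuous (fun xi : 'rV[R]_m => enorm xi).
    by apply: (@enorm_continuous _ _ _ id) => y; exact: cvg_id.
  apply: openI.
    apply: (@open_comp _ _ (fun xi : 'rV[R]_m => enorm xi) [set y : R | r < y]); last exact: open_gt.
    by move=> x _; exact: ce.
  apply: (@open_comp _ _ (fun xi : 'rV[R]_m => enorm xi) [set y : R | y < D]); last exact: open_lt.
  by move=> x _; exact: ce.
have UA : U `<=` cball 0 D `\` cball 0 r.
  move=> xi [/= h1 h2]; rewrite /cball/= !subr0; split; first exact: ltW.
  by apply/negP; rewrite -ltNge.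
have U0 : (0 < lebesgue_rV m U)%E.
  apply: lebesgue_rV_open_gt0 => //; exists (((r + D) / 2) *: basis 0).
  have b1 : enorm (basis 0) = 1 by rewrite /enorm dotp_basis// sqrtr1.
  by rewrite /U/= enormZ b1 mulr1 ger0_norm; [split; lra|lra].
apply: (@lt_le_trans _ _ ((D `^ beta)%:E * lebesgue_rV m U)%E).
  by rewrite mule_gt0// lte_fin powR_gt0.
have mU : measurable U by exact: open_rV_measurable.
rewrite -integral_cst//.
apply: (@le_trans _ _ (\int[lebesgue_rV m]_(xi in U) riesz xi)%E).
  apply: ge0_le_integral => //.
  - by move=> xi _; rewrite lee_fin powR_ge0.
  - exact: measurable_riesz.
  - move=> xi [/= h1 h2]; rewrite lee_fin ler_powR_neg//; last exact: ltW.
    exact: lt_trans h1.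
apply: ge0_subset_integral => //.
- by apply: measurableD; exact: measurable_cball.
- exact: measurable_riesz.
- by move=> xi _; rewrite lee_fin powR_ge0.
Qed.

End riesz_potential.

Section model_cone.
Context {R : realType} {m : nat}.
Variables (alpha kappa : R) (delta : \bar R) (D R0 rho : R).
Hypotheses (m2 : (2 <= m)%N) (alpha_le0 : alpha <= 0) (R0_gt0 : 0 < R0)
  (kappa_gt0 : 0 < kappa) (kappa_le : kappa <= pi).
Hypothesis rho_zero : E_eq m alpha kappa delta D R0 rho 0.
Let beta := alpha - m%:R.

(** The vanishing of the minimum of the gap, moved by an orthogonal map to an arbitrary
position of the axis e.  The inequality is between extended reals, hence covers the
case of a divergent cone integral. *)
Lemma cone_dominates_annulus (e v : 'rV[R]_m) : enorm e = 1 -> enorm v = 1 ->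
  sin (kappa / 2) <= dotp v e ->
  (\int[lebesgue_rV m]_(xi in cball 0 D `\` cball (0%R : 'rV[R]_m) R0) (enorm xi `^ beta)%:E <=
   \int[lebesgue_rV m]_(xi in open_cone (rho *: e) v kappa delta `&` cball 0 D)
     (enorm xi `^ beta)%:E)%E.
Proof.
move=> e1 v1 ve.
have beta0 : beta <= 0 by rewrite subr_le0 (le_trans alpha_le0).
have [theta [Q [thetaI oQ eQ vQ]]] := planar_direction m2 e1 v1 kappa_gt0 kappa_le ve.
have [_ /(_ (cone_gap m alpha kappa delta D R0 rho theta))] := rho_zero.
have gapI : [set cone_gap m alpha kappa delta D R0 rho th | th in `[0, (pi - kappa) / 2]]
    (cone_gap m alpha kappa delta D R0 rho theta).
  by exists theta => //=; rewrite in_itv.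
move=> /(_ gapI) {gapI}; rewrite /cone_gap subr_ge0 /Rintegral -/beta -vQ -eQ.
set C' := open_cone _ _ _ _; set C := open_cone _ _ _ _.
have -> : (\int[lebesgue_rV m]_(xi in C' `&` cball 0 D) (enorm xi `^ beta)%:E =
    \int[lebesgue_rV m]_(xi in C `&` cball 0 D) (enorm xi `^ beta)%:E)%E.
  rewrite (ge0_integral_orthogonal oQ).
  - rewrite (_ : _ @^-1` _ = C `&` cball 0 D).
      by apply: eq_integral => xi _; rewrite enorm_orthogonal.
    apply/seteqP; split => xi; rewrite /C/C' /cball /= !subr0 enorm_orthogonal// scalemxAl.
      by case=> /(open_cone_orthogonal _ _ _ _ _ oQ).
    by case=> ? ?; split => //; apply/(open_cone_orthogonal _ _ _ _ _ oQ).
  - by apply: measurableI; [exact: measurable_open_cone|exact: measurable_cball].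
  - exact: measurable_riesz.
  - by move=> xi _; rewrite lee_fin powR_ge0.
set J := integral _ _ _; set I := integral _ _ _.
have I0 : (0 <= I)%E by apply: integral_ge0 => xi _; rewrite lee_fin powR_ge0.
have J0 : (0 <= J)%E by apply: integral_ge0 => xi _; rewrite lee_fin powR_ge0.
have : (J < +oo)%E by exact: riesz_annulus_lty.
by move: I J I0 J0 => [r||] [s||]//= r0 s0 _; rewrite ?leey// lee_fin.
Qed.

End model_cone.

(** * Locally uniform asymptotics of the rescaled kernel *)

Section uniform_power_asymptotics.
Context {R : realType}.
Variables (kbar : R -> R -> R) (beta : R).
Hypothesis beta_lt0 : beta < 0.
Hypothesis kbar_decreasing : forall t, 0 < t ->
  forall r s, 0 < r -> r <= s -> kbar s t <= kbar r t.
Hypothesis kbar_cvg : forall r, 0 < r -> kbar r t @[t --> 0^'+] --> r `^ beta.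

Lemma powR_root (q : R) : 0 < q -> exists g, 0 < g /\ g `^ beta = q.
Proof.
move=> q0; exists (q `^ beta^-1); rewrite powR_gt0//; split => //.
by rewrite -powRrM mulVf ?lt_eqF// powRr1// ltW.
Qed.

Lemma powR_lt1_gt1 (g : R) : 0 < g -> g `^ beta < 1 -> 1 < g.
Proof.
move=> g0; rewrite ltNge => h; rewrite ltNge; apply: contra h => g1.
by have := ler_powR_neg (ltW beta_lt0) g0 g1; rewrite powR1.
Qed.

(** Monotonicity turns pointwise convergence at r/g and r g into bounds between these
two points; g is so close to 1 that the limit r^beta varies by less than mu there. *)
Lemma kbar_power_near (mu r : R) : 1 < mu -> 0 < r ->
  exists g, 1 < g /\
   \forall t \near 0^'+, forall s, r / g < s -> s < r * g ->
     kbar s t <= mu * s `^ beta /\ s `^ beta <= mu * kbar s t.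
Proof.
move=> mu1 r0; have mu0 : 0 < mu by exact: lt_trans mu1.
(* q = g^beta: the limit loses a factor q^2 > 1/mu between r/g and r g. *)
pose q := mu `^ (- 3^-1).
have q0 : 0 < q by exact: powR_gt0.
have q3 : mu * q ^+ 3 = 1.
  rewrite -powR_mulrn ?ltW// /q -powRrM mulNr mulVf// powR_inv1 ?ltW//.
  by rewrite divff// gt_eqF.
have q1 : q < 1.
  rewrite ltNge; apply/negP => q1; have := exprn_ege1 3 q1 => h.
  by move: q3; nra.
have [g [g0 gq]] := powR_root q0.
have g1 : 1 < g by apply: powR_lt1_gt1 => //; rewrite gq.
exists g; split => //.
have l0 : 0 < r / g by rewrite divr_gt0.
have u0 : 0 < r * g by rewrite mulr_gt0.
have rb0 : 0 < r `^ beta by exact: powR_gt0.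
have lq : (r / g) `^ beta * q = r `^ beta.
  by rewrite -gq -powRM ?ltW// divfK// gt_eqF.
have uq : (r * g) `^ beta = r `^ beta * q by rewrite powRM ?ltW// gq.
have key : (r / g) `^ beta < mu * (r * g) `^ beta.
  rewrite uq -lq; have := powR_gt0 beta l0; move: (_ `^ _) => L L0.
  have -> : mu * (L * q * q) = L * (mu * q ^+ 2) by ring.
  rewrite ltr_pMr//.
  have : 1 = (mu * q ^+ 2) * q by rewrite -q3; ring.
  have : 0 < mu * q ^+ 2 by rewrite mulr_gt0// exprn_gt0.
  by nra.
have nl : \forall t \near 0^'+, kbar (r / g) t < mu * (r * g) `^ beta.
  exact: (cvgr_lt _ (kbar_cvg l0)).
have nu : \forall t \near 0^'+, (r / g) `^ beta / mu < kbar (r * g) t.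
  by apply: (cvgr_gt _ (kbar_cvg u0)); rewrite ltr_pdivrMr// [ltRHS]mulrC.
near=> t => s sl su.
have t0 : 0 < t by near: t; exact: nbhs_right_gt.
have s0 : 0 < s by exact: lt_trans sl.
have hl : kbar (r / g) t < mu * (r * g) `^ beta by near: t.
have hu : (r / g) `^ beta / mu < kbar (r * g) t by near: t.
split.
  apply: (le_trans (kbar_decreasing t0 l0 (ltW sl))); apply: (le_trans (ltW hl)).
  by rewrite ler_pM2l// ler_powR_neg// ltW.
apply: (@le_trans _ _ ((r / g) `^ beta)); first by rewrite ler_powR_neg// ltW.
move: hu; rewrite ltr_pdivrMr// [ltRHS]mulrC => /ltW hu; apply: (le_trans hu).
by rewrite ler_pM2l//; exact: kbar_decreasing (ltW su).
Unshelve. all: by end_near. Qed.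

(** Compactness of the interval makes the local bounds uniform. *)
Lemma kbar_power_uniform (a c mu : R) : 0 < a -> 1 < mu ->
  \forall t \near 0^'+, forall s, a <= s -> s <= c ->
     kbar s t <= mu * s `^ beta /\ s `^ beta <= mu * kbar s t.
Proof.
move=> a0 mu1.
pose P (t s : R) := kbar s t <= mu * s `^ beta /\ s `^ beta <= mu * kbar s t.
have /compact_near_coveringP cover := @segment_compact R a c.
have : \forall t \near 0^'+, `[a, c]%classic `<=` P t.
  apply: cover => r; rewrite /= in_itv/= => /andP[ar _].
  have r0 : 0 < r by exact: lt_le_trans ar.
  have [g [g1 Hg]] := kbar_power_near mu1 r0.
  have g0 : 0 < g by exact: lt_trans g1.
  have nr : \forall s \near r, r / g < s /\ s < r * g.
    near=> s; split; near: s.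
      by apply: lt_nbhsr; rewrite ltr_pdivrMr// ltr_pMr.
    by apply: lt_nbhsl; rewrite ltr_pMr.
  near=> s t; rewrite /P /=.
  have [sl su] : r / g < s /\ s < r * g by near: s.
  by have : forall s, r / g < s -> s < r * g -> kbar s t <= mu * s `^ beta /\ s `^ beta <= mu * kbar s t;
    [near: t|exact].
by apply: filterS => t h s as_ sc; apply: h; rewrite /= in_itv/= as_.
Unshelve. all: by end_near. Qed.

End uniform_power_asymptotics.

(** * Mass of a radial density *)

Section radial_mass.
Context {R : realType} {m : nat}.
Variable f : R -> R.
Hypothesis m_gt0 : (0 < m)%N.
Hypothesis f_continuous : forall r, 0 < r -> {for r, continuous f}.
Hypothesis f_ge0 : forall r, 0 < r -> 0 <= f r.
Implicit Types (A B : set 'rV[R]_m) (x v xi : 'rV[R]_m).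

(** The kernel is constrained for positive arguments only; the truncation is
nonnegative everywhere and changes the radial density at the origin alone. *)
Definition truncated : R -> R := f \_ `]0, +oo[.

Lemma truncatedE r : 0 < r -> truncated r = f r.
Proof. by move=> r0; rewrite /truncated patchE mem_set//= in_itv/= r0. Qed.

Lemma truncated_ge0 r : 0 <= truncated r.
Proof.
rewrite /truncated patchE; case: ifPn => // rI.
by apply: f_ge0; move: rI; rewrite inE/= in_itv/= andbT.
Qed.

Lemma measurable_truncated : measurable_fun setT truncated.
Proof.
have mI : measurable (`]0, +oo[%classic : set R) by exact: measurable_itv.
apply: (measurable_restrictT f mI).1.
apply: open_continuous_measurable_fun; first exact: interval_open.
by move=> r; rewrite inE/= in_itv/= andbT; exact: f_continuous.
Qed.

Definition density xi : \bar R := (truncated (enorm xi))%:E.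

Definition radial_mass A : \bar R := (\int[lebesgue_rV m]_(xi in A) density xi)%E.

Lemma density_ge0 xi : (0 <= density xi)%E.
Proof. by rewrite lee_fin truncated_ge0. Qed.

Lemma measurable_density A : measurable_fun A density.
Proof.
apply: (@measurable_funS _ _ _ _ setT) => //; apply/measurable_EFinP.
by apply: (measurableT_comp measurable_truncated); exact: measurable_fun_enorm.
Qed.

Lemma radial_mass_ge0 A : (0 <= radial_mass A)%E.
Proof. by apply: integral_ge0 => xi _; exact: density_ge0. Qed.

(** The integrand and the translated density differ at x only, a null set. *)
Lemma integral_kernel_translate A x : measurable A ->
  (\int[lebesgue_rV m]_(xi in A) (f (enorm (xi - x)))%:E =
   radial_mass ((fun xi => xi + x)%R @^-1` A))%E.
Proof.
move=> mA.
have msub : measurable_fun setT (fun xi : 'rV[R]_m => xi - x) by exact: measurable_fun_addv.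
have md : measurable_fun A (fun xi => density (xi - x)).
  apply: (@measurable_funS _ _ _ _ setT) => //.
  exact: (measurableT_comp (@measurable_density setT)).
have fE xi : f (enorm (xi - x)) = truncated (enorm (xi - x)) + (f 0 - truncated 0) * \1_[set x] xi.
  have [->|xix] := eqVneq xi x.
    by rewrite subrr enorm0 indicE mem_set// mulr1 addrCA subrr addr0.
  rewrite indicE memNset ?mulr0 ?addr0; last by apply/eqP.
  by rewrite truncatedE// enorm_gt0 subr_eq0.
have mx : measurable [set x].
  rewrite (_ : [set x] = cball x 0); first exact: measurable_cball.
  apply/seteqP; split => [y ->|y]; rewrite /cball/= ?subrr ?enorm0//.
  by move=> yx; apply/eqP; rewrite -subr_eq0 -enorm_eq0 eq_le yx enorm_ge0.
transitivity (\int[lebesgue_rV m]_(xi in A) density (xi - x))%E.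
  apply: ae_eq_integral => //.
    rewrite (_ : (fun xi : 'rV[R]_m => _) =
      fun xi => (truncated (enorm (xi - x)) + (f 0 - truncated 0) * \1_[set x] xi)%:E).
      apply/measurable_EFinP; apply: measurable_funD.
        by move/measurable_EFinP : md.
      by apply: measurable_funM => //; exact: measurable_indic.
    by apply/funext => xi; rewrite fE.
  exists [set x]; split => //.
    by clear -m_gt0; case: m m_gt0 x => // n _ x; exact: lebesgue_rV_set1.
  move=> xi /= h; apply: contrapT => /eqP xix; apply: h => _.
  by rewrite /density truncatedE// enorm_gt0 subr_eq0.
rewrite (ge0_integral_translate x)//; last by move=> xi _; exact: density_ge0.
by apply: eq_integral => xi _; rewrite addrK.
Qed.

Lemma integral_kernel A : measurable A ->
  (\int[lebesgue_rV m]_(xi in A) (f (enorm xi))%:E = radial_mass A)%E.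
Proof.
move=> mA; transitivity (\int[lebesgue_rV m]_(xi in A) (f (enorm (xi - 0)))%:E)%E.
  by apply: eq_integral => xi _; rewrite subr0.
rewrite integral_kernel_translate//; congr radial_mass.
by apply/seteqP; split => xi /=; rewrite addr0.
Qed.

Lemma radial_massS A B : measurable A -> measurable B -> A `<=` B ->
  (radial_mass A <= radial_mass B)%E.
Proof.
move=> mA mB AB; apply: ge0_subset_integral => //; first exact: measurable_density.
by move=> xi _; exact: density_ge0.
Qed.

Lemma radial_massID A B : measurable A -> measurable B ->
  (radial_mass A = radial_mass (A `&` B) + radial_mass (A `\` B))%E.
Proof.
move=> mA mB; rewrite -{1}(setUIDK A B) /radial_mass ge0_integral_setU//.
- exact: measurableI.
- exact: measurableD.
- exact: measurable_density.
- by move=> xi _; exact: density_ge0.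
- by rewrite disj_set2E setDE setIACA setICr setI0.
Qed.

Lemma radial_massU_le A B : measurable A -> measurable B ->
  (radial_mass (A `|` B) <= radial_mass A + radial_mass B)%E.
Proof.
move=> mA mB; rewrite (@radial_massID (A `|` B) A)//; last exact: measurableU.
apply: leeD.
  by apply: radial_massS => //; apply: measurableI => //; exact: measurableU.
apply: radial_massS => //; first by apply: measurableD => //; exact: measurableU.
by move=> xi [[]].
Qed.

Lemma radial_mass_set0 : radial_mass set0 = 0%E.
Proof. exact: integral_set0. Qed.

Lemma radial_mass_orthogonal Q A : orthogonal_mx Q -> measurable A ->
  radial_mass ((fun xi => xi *m Q) @^-1` A) = radial_mass A.
Proof.
move=> oQ mA; rewrite /radial_mass (ge0_integral_orthogonal oQ mA).
- by apply: eq_integral => xi _; rewrite /density enorm_orthogonal.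
- exact: measurable_density.
- by move=> xi _; exact: density_ge0.
Qed.

(** Some orthogonal map carries one axis to the other and preserves the density. *)
Lemma radial_mass_cone v w kappa delta : enorm v = 1 -> enorm w = 1 ->
  radial_mass (open_cone 0 v kappa delta) = radial_mass (open_cone 0 w kappa delta).
Proof.
move=> v1 w1; have [|||Q [oQ _ vQ]] := @orthogonal_pair_transport R m v v w w.
- by rewrite v1 w1.
- by rewrite v1 w1.
- by rewrite !dotp_enorm1.
rewrite -(radial_mass_orthogonal oQ (measurable_open_cone 0 w kappa delta)) -vQ.
congr radial_mass; apply/seteqP; split => xi /= h.
  by rewrite -(mul0mx _ Q); apply/(open_cone_orthogonal _ _ _ _ _ oQ).
by apply/(open_cone_orthogonal _ _ _ _ _ oQ); rewrite mul0mx.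
Qed.

End radial_mass.

Section finite_cone_cover.
Context {R : realType} {m : nat}.

(** Compactness of the unit sphere; the condition is homogeneous in xi. *)
Lemma sphere_cone_cover (kappa : R) : 0 < kappa -> kappa <= pi ->
  exists s : seq 'rV[R]_m, (forall v, v \in s -> enorm v = 1) /\
    forall xi : 'rV[R]_m, xi != 0 -> exists2 v, v \in s & cos (kappa / 2) * enorm xi < dotp xi v.
Proof.
move=> kappa0 kappapi; have pi0 := pi_gt0 R.
have g1 : cos (kappa / 2) < 1.
  have h0 : 0 <= (0 : R) <= pi by rewrite lexx ltW.
  have hk : 0 <= kappa / 2 <= pi by apply/andP; split; lra.
  by have := ltr_cos h0 hk; rewrite cos0 divr_gt0.
pose S := [set v : 'rV[R]_m | enorm v = 1].
have ce : continuous (fun xi : 'rV[R]_m => enorm xi).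
  by apply: (@enorm_continuous _ _ _ id) => y; exact: cvg_id.
have cS : compact S.
  apply: (subclosed_compact _ (@cball_compact R m 0 1)).
    apply: (@closed_comp _ _ (fun v : 'rV[R]_m => enorm v) [set s : R | s = 1]); last exact: closed_eq.
    by move=> v _; exact: ce.
  by move=> v /= v1; rewrite /cball/= subr0 v1.
move: cS; rewrite compact_cover => /(_ _ S (fun v => open_cone 0 v kappa +oo%E)).
move=> [|v Sv|D DS Scov].
- by move=> v _; exact: open_open_cone.
- exists v => //; apply/open_coneP; rewrite subr0 ltry; split => //.
  by rewrite Sv mulr1 dotp_enorm1.
exists (finmap.enum_fset D); split.
  by move=> v vD; have := DS v vD; rewrite inE.
move=> xi xi0; have [v vD /open_coneP[_]] := Scov _ (enorm_normalize xi0).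
rewrite subr0 enorm_normalize// mulr1 dotpZl => h; exists v => //.
by rewrite -ltr_pdivlMr ?enorm_gt0// [ltRHS]mulrC.
Qed.

End finite_cone_cover.

(** * Cones at the origin against the tail *)

Lemma cvge0_near_lt {R : realType} {T : Type} {F : set_system T} {FF : Filter F}
    (u : T -> \bar R) (e : R) : u x @[x --> F] --> 0%E -> 0 < e ->
  \forall x \near F, (u x < e%:E)%E.
Proof.
move=> /fine_cvgP[ufin u0] e0.
near=> x.
have ux : u x \is a fin_num by near: x.
rewrite -(fineK ux) lte_fin; near: x.
exact: (cvgr_lt _ u0).
Unshelve. all: by end_near. Qed.

Section kernel_mass.
Context {R : realType} {m : nat}.
Variables (alpha : R) (k : R -> R -> R) (kappa : R) (delta : \bar R).
Hypothesis m2 : (2 <= m)%N.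
Hypothesis alpha_le0 : alpha <= 0.
Hypothesis kernel_k : kernel_conditions m alpha k.
Hypotheses (kappa_gt0 : 0 < kappa) (kappa_le : kappa <= pi) (delta_gt0 : (0 < delta)%E).
Let m_gt0 : (0 < m)%N := ltnW m2.
Notation mass t := (@radial_mass R m (k^~ t)).

Lemma kernel_continuous t : 0 < t -> forall r, 0 < r -> {for r, continuous (k^~ t)}.
Proof. by move=> t0 r r0; have [beta _ [c _ _ _]] := kernel_C0 kernel_k t0; exact: c. Qed.

Lemma kernel_gt0 t : 0 < t -> forall r, 0 < r -> 0 < k r t.
Proof.
move=> t0 r r0; have [psi [kbar [psi0 kbar0 kE _]]] := kernel_scaling kernel_k.
by rewrite kE// mulr_gt0 ?psi0 ?kbar0.
Qed.

Lemma kernel_ge0 t : 0 < t -> forall r, 0 < r -> 0 <= k r t.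
Proof. by move=> t0 r r0; rewrite ltW// kernel_gt0. Qed.

Lemma kernel_nonincreasing t : 0 < t -> forall r s, 0 < r -> r <= s -> k s t <= k r t.
Proof.
move=> t0 r s r0; rewrite le_eqVlt => /predU1P[->//|rs].
by rewrite ltW// (kernel_decreasing kernel_k).
Qed.

Lemma mass_setT t : 0 < t -> mass t setT = 1%E.
Proof.
move=> t0; rewrite -(kernel_mass kernel_k t0).
by rewrite (integral_kernel m_gt0 (kernel_continuous t0) (kernel_ge0 t0)).
Qed.

Lemma mass_le1 t (A : set 'rV[R]_m) : 0 < t -> measurable A -> (mass t A <= 1)%E.
Proof.
move=> t0 mA; rewrite -(mass_setT t0); apply: radial_massS => //.
- exact: kernel_continuous.
- exact: kernel_ge0.
Qed.

Lemma mass_fin_num t (A : set 'rV[R]_m) : 0 < t -> measurable A -> mass t A \is a fin_num.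
Proof.
move=> t0 mA; rewrite ge0_fin_numE ?(le_lt_trans (mass_le1 t0 mA)) ?ltry//.
by apply: radial_mass_ge0; exact: kernel_ge0.
Qed.

Lemma massID t (A B : set 'rV[R]_m) : 0 < t -> measurable A -> measurable B ->
  (mass t A = mass t (A `&` B) + mass t (A `\` B))%E.
Proof.
move=> t0 mA mB; apply: radial_massID => //.
- exact: kernel_continuous.
- exact: kernel_ge0.
Qed.

Lemma massS t (A B : set 'rV[R]_m) : 0 < t -> measurable A -> measurable B -> A `<=` B ->
  (mass t A <= mass t B)%E.
Proof.
move=> t0 mA mB; apply: radial_massS => //.
- exact: kernel_continuous.
- exact: kernel_ge0.
Qed.

Lemma mass_concentration rho e : 0 < rho -> 0 < e ->
  \forall t \near 0^'+, (mass t (~` cball 0 rho) < e%:E)%E.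
Proof.
move=> rho0 e0; have h := cvge0_near_lt (kernel_concentration kernel_k rho0) e0.
near=> t; have t0 : 0 < t by near: t; exact: nbhs_right_gt.
rewrite -(integral_kernel m_gt0 (kernel_continuous t0) (kernel_ge0 t0)).
  by near: t; exact: h.
by apply: measurableC; exact: measurable_cball.
Unshelve. all: by end_near. Qed.

Lemma mass_cones_le t (s : seq 'rV[R]_m) v : 0 < t -> enorm v = 1 ->
  (forall w, w \in s -> enorm w = 1) ->
  (mass t (\big[setU/set0]_(w <- s) open_cone 0 w kappa delta) <=
   (size s)%:R%:E * mass t (open_cone 0 v kappa delta))%E.
Proof.
move=> t0 v1; elim: s => [|w s ih] s1.
  by rewrite big_nil radial_mass_set0 mul0e.
rewrite big_cons.
apply: le_trans (_ : _ <=
  (1%:R%:E + (size s)%:R%:E) * mass t (open_cone 0 v kappa delta))%E _.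
  rewrite ge0_muleDl ?lee_fin// mul1e.
  apply: (le_trans (radial_massU_le _ _ _ _)).
  - exact: kernel_continuous.
  - exact: kernel_ge0.
  - exact: measurable_open_cone.
  - by apply: bigsetU_measurable => u _; exact: measurable_open_cone.
  apply: leeD; last by apply: ih => u us; apply: s1; rewrite inE us orbT.
  rewrite (@radial_mass_cone _ _ _ _ _ w v)//.
  - exact: kernel_continuous.
  - exact: kernel_ge0.
  - by apply: s1; rewrite inE eqxx.
by rewrite -EFinD -natrD.
Qed.

(** A ball around 0 is covered, up to the origin, by N cones of equal mass, so this mass
is at least 1/(2N) once the mass outside the ball is below 1/2. *)
Lemma cone_mass_dominates_tail (R0 : R) : 0 < R0 ->
  \forall t \near 0^'+, forall v : 'rV[R]_m, enorm v = 1 ->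
    (mass t (~` cball 0 R0) < mass t (open_cone 0 v kappa delta))%E.
Proof.
move=> R0_gt0; have [d d0 dd] := ereal_gt0_real delta_gt0.
have [s [s1 scov]] := @sphere_cone_cover R m kappa kappa_gt0 kappa_le.
(* The successor avoids dividing by 0 when the cover is empty. *)
pose e : R := (2 * (size s).+1%:R)^-1.
have N0 : 0 < (size s).+1%:R :> R by rewrite ltr0n.
have e0 : 0 < e by rewrite invr_gt0 mulr_gt0.
have h0 : 0 < 2^-1 :> R by rewrite invr_gt0.
near=> t => v v1.
have t0 : 0 < t by near: t; exact: nbhs_right_gt.
have hR : (mass t (~` cball 0 R0) < e%:E)%E by near: t; exact: mass_concentration.
have hd : (mass t (~` cball 0 d) < (2^-1)%:E)%E by near: t; exact: mass_concentration.
rewrite ltNge; apply/negP => hv.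
have mC w : measurable (open_cone (0 : 'rV[R]_m) w kappa delta) by exact: measurable_open_cone.
have md : measurable (cball (0 : 'rV[R]_m) d) by exact: measurable_cball.
have m0 : measurable (cball (0 : 'rV[R]_m) 0) by exact: measurable_cball.
have cfin := mass_fin_num t0 (mC v).
have hb := mass_cones_le t0 v1 s1.
have U0 : (mass t (cball 0 d) <= mass t (\big[setU/set0]_(w <- s) open_cone 0 w kappa delta))%E.
  rewrite (massID t0 md m0) [X in (X + _)%E](_ : _ = 0%E); last first.
    rewrite /radial_mass integral0_eq// => xi [_]; rewrite /cball/= subr0 => xi0.
    have /eqP -> : xi == 0 by rewrite -enorm_eq0 eq_le xi0 enorm_ge0.
    by rewrite /density enorm0 /truncated patchE memNset//= in_itv/= ltxx.
  rewrite add0e; apply: massS => //.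
  - exact: measurableD.
  - by apply: bigsetU_measurable => w _.
  - move=> xi [xid xi0].
    have xin0 : xi != 0.
      by apply/eqP => E; apply: xi0; rewrite E /cball/= subrr enorm0.
    have [w ws xiw] := scov _ xin0; rewrite -bigcup_seq; exists w => //.
    apply/open_coneP; rewrite subr0; split => //.
    by apply: le_lt_trans dd; move: xid; rewrite /cball/= subr0 lee_fin.
have := massID t0 measurableT md; rewrite setTI setTD mass_setT// => hT.
move: hT hd U0 hb hv hR.
rewrite -(fineK cfin) -(fineK (mass_fin_num t0 md)).
rewrite -(fineK (mass_fin_num t0 (measurableC md))).
rewrite -(fineK (mass_fin_num t0 (measurableC (measurable_cball (0 : 'rV[R]_m) R0)))).
set a := fine _; set a' := fine _; set c := fine _; set b := fine _.
rewrite -EFinD -EFinM lte_fin => -[hT] hd U0 hb; rewrite lee_fin lte_fin => hv hR.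
have : a <= (size s)%:R * c by rewrite -lee_fin; exact: le_trans U0 hb.
have ce : c < e by exact: le_lt_trans hv hR.
have : (size s)%:R * c <= (size s)%:R * e by rewrite ler_wpM2l// ltW.
have : (size s)%:R * e <= 2^-1.
  have eN : e * (2 * (size s).+1%:R) = 1 by rewrite mulVf// gt_eqF// mulr_gt0.
  have : (size s)%:R * e <= (size s).+1%:R * e by rewrite ler_wpM2r ?(ltW e0)// ler_nat.
  move: eN; move: ((size s)%:R : R) ((size s).+1%:R : R) => N N'; lra.
lra.
Unshelve. all: by end_near. Qed.

End kernel_mass.

(** * Shifted cones against the annulus *)

Section shifted_cone.
Context {R : realType} {m : nat}.
Variables (kappa : R) (delta : \bar R) (D b rho : R).
Hypotheses (b_lt1 : b < 1) (rho_gt0 : 0 < rho) (D_gt0 : 0 < D).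

(** On the shifted cone, |eta - s e|^2 is at most |eta|^2 - (1 - b) rho^2.  Dividing by
|eta|^2, which is at most the squared maximum of D and rho, gives a uniform
contraction factor; the maximum makes the radicand positive for every D. *)
Definition shrink : R := Num.sqrt (1 - (1 - b) * rho ^+ 2 / Num.max D rho ^+ 2).

Lemma shrink_bounds : 0 < b -> 0 < shrink < 1.
Proof.
move=> b_gt0.
have M0 : 0 < Num.max D rho by rewrite lt_max D_gt0.
have rM : rho ^+ 2 <= Num.max D rho ^+ 2.
  by rewrite ler_sqr ?nnegrE ?(ltW M0) ?(ltW rho_gt0)// le_max lexx orbT.
have M2 : 0 < Num.max D rho ^+ 2 by rewrite exprn_gt0.
have r2 : 0 < rho ^+ 2 by rewrite exprn_gt0.
have q0 : 0 < (1 - b) * rho ^+ 2 / Num.max D rho ^+ 2.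
  by rewrite divr_gt0// mulr_gt0// subr_gt0.
have q1 : (1 - b) * rho ^+ 2 / Num.max D rho ^+ 2 < 1.
  rewrite ltr_pdivrMr// mul1r; move: rM M2 r2.
  move: (rho ^+ 2) (_ ^+ 2) => P Q PQ Q0 P0.
  apply: lt_le_trans PQ; rewrite gtr_pMl//; lra.
rewrite /shrink sqrtr_gt0 subr_gt0 q1/=.
rewrite -[ltRHS]sqrtr1 ltr_sqrt// ltrBlDr ltrDl//.
Qed.

(** Points eta of the cone at rho e satisfy eta.e >= rho, hence with s = rho - r,
|eta - s e|^2 <= |eta|^2 - s (2 rho - s), where s >= (1 - b) rho and
2 rho - s >= rho. *)
Lemma shifted_cone_contracts (e v eta : 'rV[R]_m) r : enorm e = 1 ->
  (forall w, cos (kappa / 2) * enorm w < dotp w v -> 0 <= dotp w e) ->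
  0 < r -> r <= b * rho ->
  open_cone (rho *: e) v kappa delta eta -> enorm eta <= D ->
  [/\ rho <= enorm eta, 0 < enorm (eta - (rho - r) *: e)
    & enorm (eta - (rho - r) *: e) <= shrink * enorm eta].
Proof.
move=> e1 dual r0 rb /open_coneP[_ /dual].
have ee : dotp e e = 1 by exact: dotp_enorm1.
rewrite dotpDl dotpNl dotpZl ee mulr1 subr_ge0 => etae etaD.
have CS (u : 'rV[R]_m) : dotp u e <= enorm u.
  by have := CauchySchwarz_dotp u e; rewrite e1 mulr1.
have eta_rho : rho <= enorm eta by exact: le_trans (CS eta).
split => //.
  apply: lt_le_trans (CS _); rewrite dotpDl dotpNl dotpZl ee; lra.
have M0 : 0 < Num.max D rho by rewrite lt_max D_gt0.
have etaM : enorm eta ^+ 2 <= Num.max D rho ^+ 2.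
  by rewrite ler_sqr ?nnegrE ?enorm_ge0 ?(ltW M0)// le_max etaD.
have M2 : 0 < Num.max D rho ^+ 2 by rewrite exprn_gt0.
rewrite -(ger0_norm (enorm_ge0 eta)) -sqrtr_sqr /shrink.
set q := _ / _; have q0 : 0 <= q.
  by rewrite divr_ge0 ?mulr_ge0 ?subr_ge0 ?sqr_ge0// ltW.
rewrite mulrC -sqrtrM ?sqr_ge0// /enorm -[X in Num.sqrt (X ^+ 2 * _)]/(enorm eta).
apply: ler_wsqrtr; rewrite !dotpE ee (dotpC e eta) -(sqr_enorm eta).
have qM : q * enorm eta ^+ 2 <= (1 - b) * rho ^+ 2.
  rewrite /q mulrAC ler_pdivrMr// ler_wpM2l// mulr_ge0 ?sqr_ge0// subr_ge0 ltW//.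
move: qM etae; move: (enorm eta ^+ 2) (dotp eta e) => N p qN rp.
have s0 : (1 - b) * rho <= rho - r by lra.
have s1 : rho - r <= rho by lra.
move: s0 s1; move: (rho - r) => s s0 s1.
have sge0 : 0 <= s by apply: le_trans s0; rewrite mulr_ge0 ?subr_ge0 ?(ltW b_lt1) ?(ltW rho_gt0).
have sp : s * rho <= s * p by exact: ler_wpM2l.
have ss : s * s <= s * rho by exact: ler_wpM2l.
have sr : (1 - b) * rho * rho <= s * rho by apply: ler_wpM2r => //; exact: ltW.
nra.
Qed.

End shifted_cone.

Section annulus_vs_cone.
Context {R : realType} {m : nat}.
Variables (alpha : R) (k : R -> R -> R) (kappa : R) (delta : \bar R) (D R0 b rho : R).
Hypothesis m2 : (2 <= m)%N.
Hypothesis alpha_le0 : alpha <= 0.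
Hypothesis kernel_k : kernel_conditions m alpha k.
Hypotheses (kappa_gt0 : 0 < kappa) (kappa_le : kappa <= pi).
Hypotheses (R0_gt0 : 0 < R0) (R0D : R0 < D) (b_gt0 : 0 < b) (b_lt1 : b < 1).
Hypothesis rho_gt0 : 0 < rho.
Hypothesis rho_zero : E_eq m alpha kappa delta D R0 rho 0.
Notation mass t := (@radial_mass R m (k^~ t)).

(** With q = gamma^beta > 1 for the contraction factor gamma, the uniform asymptotics
with tolerance mu = q^(1/3) bound the mass of the annulus by psi mu J and the mass of
the cone below by psi (q/mu) J; these are separated because mu^2 < q. *)
Lemma cone_mass_dominates_annulus :
  \forall t \near 0^'+, forall (r : R) (e v : 'rV[R]_m),
    0 < r -> r <= b * rho -> enorm e = 1 -> enorm v = 1 ->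
    (forall w, cos (kappa / 2) * enorm w < dotp w v -> 0 <= dotp w e) ->
    (mass t (cball 0 D `\` cball 0 R0) <
     mass t (open_cone (r *: e) v kappa delta `&` cball 0 D))%E.
Proof.
have D_gt0 : 0 < D by exact: lt_trans R0D.
have m_gt0 : (0 < m)%N by exact: ltnW.
pose beta := alpha - m%:R.
have beta_lt0 : beta < 0.
  by rewrite subr_lt0 (le_lt_trans alpha_le0)// ltr0n.
have beta_le0 := ltW beta_lt0.
pose gam := shrink D b rho.
have /andP[gam0 gam1] : 0 < gam < 1 by exact: shrink_bounds.
pose q := gam `^ beta.
have q0 : 0 < q by exact: powR_gt0.
have q1 : 1 < q.
  rewrite /q -(opprK beta) powRN invf_gt1 ?powR_gt0//.
  have := @gt0_ltr_powR R (- beta) _ gam 1; rewrite powR1; apply => //.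
  - by rewrite oppr_gt0.
  - by rewrite nnegrE ltW.
  - by rewrite nnegrE.
pose mu := q `^ 3^-1.
have mu0 : 0 < mu by exact: powR_gt0.
have mu3 : mu ^+ 3 = q.
  by rewrite -powR_mulrn ?ltW// /mu -powRrM mulVf// powRr1// ltW.
have mu1 : 1 < mu.
  rewrite ltNge; apply/negP => mu1.
  by have := exprn_ile1 3 (ltW mu0) mu1; rewrite mu3 leNgt q1.
have [psi [kbar [psi0 kbar0 kE kbar_cvg]]] := kernel_scaling kernel_k.
have kbar_decr t : 0 < t -> forall r s, 0 < r -> r <= s -> kbar s t <= kbar r t.
  move=> t0 r s r0 rs; have s0 : 0 < s by exact: lt_le_trans rs.
  rewrite -(ler_pM2l (psi0 _ t0)) -(kE s t)// -(kE r t)//.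
  exact: (kernel_nonincreasing kernel_k).
near=> t.
have t0 : 0 < t by near: t; exact: nbhs_right_gt.
have Hup : forall s, R0 <= s -> s <= D ->
    kbar s t <= mu * s `^ beta /\ s `^ beta <= mu * kbar s t.
  by near: t; exact: kbar_power_uniform.
have Hlow : forall s, gam * rho <= s -> s <= D ->
    kbar s t <= mu * s `^ beta /\ s `^ beta <= mu * kbar s t.
  by near: t; apply: kbar_power_uniform => //; exact: mulr_gt0.
move=> r e v r0 rb e1 v1 dual.
have kcont := kernel_continuous kernel_k t0.
have kge0 := kernel_ge0 kernel_k t0.
have ve := cone_dual_dir v1 e1 kappa_gt0 kappa_le dual.
have := cone_dominates_annulus m2 alpha_le0 R0_gt0 kappa_gt0 kappa_le rho_zero e1 v1 ve.
rewrite -/beta.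
set J := integral _ _ _; set I := integral _ _ _ => JI.
have J0 : (0 < J)%E by exact: riesz_annulus_gt0.
have Jfin : J \is a fin_num.
  by rewrite ge0_fin_numE ?ltW//; exact: riesz_annulus_lty.
have mA : measurable (cball (0 : 'rV[R]_m) D `\` cball 0 R0).
  by apply: measurableD; exact: measurable_cball.
have mC (x : 'rV[R]_m) : measurable (open_cone x v kappa delta `&` cball 0 D).
  by apply: measurableI; [exact: measurable_open_cone|exact: measurable_cball].
apply: (@le_lt_trans _ _ ((psi t * mu)%:E * J)%E).
  rewrite /J -ge0_integralZl_EFin//.
  - apply: ge0_le_integral => //.
    + by move=> xi _; exact: density_ge0.
    + exact: measurable_density.
    + apply: measurable_funeM; exact: measurable_riesz.
    + move=> xi [xiD]; rewrite /cball/= subr0 => /negP; rewrite -ltNge => xiR0.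
      have xi0 : 0 < enorm xi by exact: lt_trans xiR0.
      rewrite /density truncatedE// kE// -EFinM lee_fin -mulrA ler_pM2l ?psi0//.
      by apply: (Hup _ _ _).1; [exact: ltW|move: xiD; rewrite /cball/= subr0].
  - by move=> xi _; rewrite lee_fin powR_ge0.
  - exact: measurable_riesz.
  - by rewrite mulr_ge0 ?ltW ?psi0.
apply: (@lt_le_trans _ _ ((psi t * (q / mu))%:E * J)%E).
  rewrite lte_pmul2r// lte_fin ltr_pM2l ?psi0// ltr_pdivlMr// -mu3.
  by rewrite -expr2 ltr_eXn2l.
apply: (@le_trans _ _ ((psi t * (q / mu))%:E * I)%E).
  by rewrite lee_wpmul2l// lee_fin mulr_ge0 ?divr_ge0 ?ltW ?psi0.
pose c : 'rV[R]_m := - ((rho - r) *: e).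
have mc : measurable_fun setT (fun xi : 'rV[R]_m => xi + c) by exact: measurable_fun_addv.
have shift : open_cone (rho *: e) v kappa delta `&` cball 0 D `<=`
    (fun xi => xi + c) @^-1` (open_cone (r *: e) v kappa delta `&` cball 0 D).
  move=> eta [etaC]; rewrite /cball/= !subr0 => etaD.
  have [h1 h2 h3] := shifted_cone_contracts b_lt1 rho_gt0 D_gt0 e1 dual r0 rb etaC etaD.
  split.
    apply/(open_cone_translate ((rho - r) *: e)); rewrite /c subrK -scalerDl.
    by rewrite addrC subrK.
  apply: (le_trans h3); apply: le_trans etaD.
  by rewrite ler_piMl ?enorm_ge0// ltW.
rewrite /radial_mass (ge0_integral_translate c); last 3 first.
- exact: mC.
- exact: measurable_density.
- by move=> xi _; exact: density_ge0.
have mdens (A : set 'rV[R]_m) : measurable_fun A (fun xi => density (k^~ t) (xi + c)).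
  apply: (@measurable_funS _ _ _ _ setT) => //.
  by apply: (measurableT_comp _ mc); exact: measurable_density.
apply: le_trans (_ : _ <= \int[lebesgue_rV m]_(xi in open_cone (rho *: e) v kappa delta `&` cball 0 D)
   density (k^~ t) (xi + c))%E _; last first.
  apply: ge0_subset_integral => //.
    by apply: (preimage_measurable mc); exact: mC.
  by move=> xi _; exact: density_ge0.
have pq0 : 0 <= psi t * (q / mu).
  by rewrite mulr_ge0 ?(ltW (psi0 _ t0)) ?(ltW (divr_gt0 q0 mu0)).
rewrite /I -ge0_integralZl_EFin//.
- apply: ge0_le_integral => //.
  + by move=> xi _; rewrite -EFinM lee_fin mulr_ge0 ?powR_ge0.
  + apply: measurable_funeM; exact: measurable_riesz.
  + move=> eta [etaC]; rewrite /cball/= subr0 => etaD.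
    have [h1 h2 h3] := shifted_cone_contracts b_lt1 rho_gt0 D_gt0 e1 dual r0 rb etaC etaD.
    have eta0 : 0 < enorm eta by exact: lt_le_trans h1.
    rewrite /density truncatedE// -EFinM lee_fin.
    apply: (@le_trans _ _ (k (gam * enorm eta) t)); last first.
      exact: (kernel_nonincreasing kernel_k).
    rewrite kE// ?mulr_gt0// -mulrA ler_pM2l ?psi0// mulrAC ler_pdivrMr//.
    rewrite /q -powRM ?enorm_ge0 ?(ltW gam0)// [leRHS]mulrC.
    apply: (Hlow _ _ _).2; first by rewrite ler_pM2l.
    by apply: le_trans etaD; rewrite ler_piMl ?enorm_ge0// ltW.
- by move=> xi _; rewrite lee_fin powR_ge0.
- exact: measurable_riesz.
Unshelve. all: by end_near. Qed.

End annulus_vs_cone.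

(** * Bodies, distances and the comparison of potentials *)

Section bodies.
Context {R : realType} {m : nat}.
Implicit Types (A X Y : set 'rV[R]_m) (x y z : 'rV[R]_m).

Lemma dist_lower_bound A x : lbound [set enorm (x - a) | a in A] 0.
Proof. by move=> _ [a _ <-]; exact: enorm_ge0. Qed.

Lemma dist_le A x a : A a -> dist x A <= enorm (x - a).
Proof.
move=> Aa; apply: ge_inf; last by exists a.
by exists 0; exact: dist_lower_bound.
Qed.

Lemma le_dist A x r : A !=set0 -> (forall a, A a -> r <= enorm (x - a)) -> r <= dist x A.
Proof.
move=> [a Aa] rA; apply: lb_le_inf; first by exists (enorm (x - a)), a.
by move=> _ [a' Aa' <-]; exact: rA.
Qed.

Lemma body_closed X : body X -> closed X.
Proof. by move=> [U [_ _ ->]]; exact: closed_closure. Qed.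

(** The closure of a bounded set stays inside any closed ball containing the set. *)
Lemma body_bounded X : body X -> exists M, forall x, X x -> enorm x <= M.
Proof.
move=> [U [_ [M UM] ->]]; exists M.
have : closure U `<=` cball 0 M.
  rewrite closureE; apply: smallest_sub.
    by apply: compact_closed; [exact: norm_hausdorff|exact: cball_compact].
  by move=> x /UM; rewrite /cball/= subr0.
by move=> h x /h; rewrite /cball/= subr0.
Qed.

Lemma body_setC_nonempty X : (0 < m)%N -> body X -> ~` X !=set0.
Proof.
move=> m0 /body_bounded[M XM]; exists ((`|M| + 1) *: Defs.basis 0) => /XM.
have b1 : enorm (Defs.basis 0 : 'rV[R]_m) = 1 by rewrite /enorm dotp_basis// sqrtr1.
rewrite enormZ b1 mulr1 ger0_norm ?addr_ge0// => h.
have := ler_norm M; lra.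
Qed.

(** Points at distance less than [R0] from x lie in [X] by definition of the distance;
those at distance exactly [R0] do because [X] is closed. *)
Lemma dist_setC_cball X x R0 : closed X -> 0 < R0 -> R0 <= dist x (~` X) ->
  cball 0 R0 `<=` (fun xi => xi + x) @^-1` X.
Proof.
move=> clX R00 R0x z; rewrite /cball/= subr0 => zR0; apply: contrapT => nXz.
have oX : open (~` X) by exact: closed_openC.
have /nbhs_ballP[e /= e0 eX] : nbhs (z + x) (~` X) by exact: open_nbhs_nbhs.
(* (1 - s) z + x is closer to x than R0, yet still in the neighbourhood of z + x. *)
pose s := Num.min 2^-1 (e / (R0 + R0)).
have s0 : 0 < s by rewrite lt_min invr_gt0 ltr0n divr_gt0// addr_gt0.
have s1 : s < 1 by rewrite gt_min invf_lt1// ltr1n.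
have sR : s * R0 < e.
  apply: (@le_lt_trans _ _ (e / (R0 + R0) * R0)).
    by rewrite ler_wpM2r ?(ltW R00)// ge_min lexx orbT.
  by rewrite mulrAC ltr_pdivrMr ?addr_gt0// mulrDr ltrDl mulr_gt0.
have : (~` X) ((1 - s) *: z + x).
  apply: eX; split => // i j; rewrite (ord1 i) /ball/= !mxE.
  rewrite (_ : _ - _ = s * z ord0 j); last by ring.
  rewrite normrM gtr0_norm//; apply: le_lt_trans sR; rewrite ler_wpM2l ?(ltW s0)//.
  exact: le_trans (coord_le_enorm z j) zR0.
move=> /(@dist_le _ x) h; have := le_trans R0x h.
rewrite opprD addrCA subrr addr0 enormN enormZ ger0_norm ?subr_ge0 ?(ltW s1)// => h'.
have : (1 - s) * enorm z <= (1 - s) * R0 by rewrite ler_wpM2l// subr_ge0 ltW.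
nra.
Qed.

Lemma diam_ge Y y z : body Y -> Y y -> Y z -> enorm (z - y) <= diam Y.
Proof.
move=> /body_bounded[M YM] Yy Yz; apply: ub_le_sup; last by exists (z, y).
exists (M + M) => _ [[p q] [/= /YM pM /YM qM] <-].
by rewrite (le_trans (ler_enormD _ _))// enormN lerD.
Qed.

End bodies.

Lemma at_right0_near {R : realType} (P : R -> Prop) : (\forall t \near 0^'+, P t) ->
  exists2 tau, 0 < tau & forall t, 0 < t -> t < tau -> P t.
Proof.
move=> [tau /= tau0 H]; exists tau => // t t0 tt; apply: H => //.
by rewrite /ball/= sub0r normrN gtr0_norm.
Qed.

Lemma lte_of_complements {R : realType} (a b c d : \bar R) :
  a \is a fin_num -> b \is a fin_num -> c \is a fin_num -> d \is a fin_num ->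
  (a + b = c + d -> d < b -> a < c)%E.
Proof.
move: a b c d => [a| |] [b| |] [c| |] [d| |]//= _ _ _ _ [abcd]; rewrite !lte_fin; lra.
Qed.

Theorem theorem4p7 (R : realType) (m : nat) (alpha : R) (k : R -> R -> R)
    (X Y : set 'rV[R]_m) (kappa : R) (delta : \bar R) (R0 : R) :
  (2 <= m)%N -> alpha <= 0 ->
  kernel_conditions m alpha k ->
  body X -> body Y ->
  0 < kappa -> kappa <= pi -> (0 < delta)%E ->
  uniform_interior_cone (~` Y) kappa delta ->
  0 < R0 -> R0 < diam Y ->
  forall b : R, 0 < b -> b < 1 ->
  exists2 tau : R, 0 < tau &
    forall t : R, 0 < t -> t < tau ->
    forall x y : 'rV[R]_m,
      X x -> R0 <= dist x (~` X) ->
      dist y (~` Y) <= b * Rtilde m alpha kappa delta (diam Y) R0 ->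
      (potential k Y y t < potential k X x t)%E.
Proof.
move=> m2 alpha_le0 kernel_k bodyX bodyY kappa0 kappapi delta0 [oYc coneY] R00 R0D b b0 b1.
have m0 : (0 < m)%N by exact: ltnW.
set D := diam Y in R0D *; set rho := Rtilde _ _ _ _ _ _.
have mX : measurable X by apply: closed_rV_measurable; exact: body_closed.
have mY : measurable Y by apply: closed_rV_measurable; exact: body_closed.
have tail := cone_mass_dominates_tail m2 kernel_k kappa0 kappapi delta0 R00.
have annulus : \forall t \near 0^'+, 0 < rho -> forall (r : R) (e v : 'rV[R]_m),
    0 < r -> r <= b * rho -> enorm e = 1 -> enorm v = 1 ->
    (forall w, cos (kappa / 2) * enorm w < dotp w v -> 0 <= dotp w e) ->
    (radial_mass (k^~ t) (cball (0 : 'rV[R]_m) D `\` cball 0 R0) <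
     radial_mass (k^~ t) (open_cone (r *: e) v kappa delta `&` cball 0 D))%E.
  have [rho0|_] := ltP 0 rho; last by near=> t.
  (* Rtilde is either a zero of E or the default value 0, so being positive
     makes it a zero. *)
  have rho_zero : E_eq m alpha kappa delta D R0 rho 0.
    by move: rho0; rewrite /rho /Rtilde; case: xgetP => [r _ [_]//|_]; rewrite ltxx.
  by apply: filterS (cone_mass_dominates_annulus m2 alpha_le0 kernel_k kappa0 kappapi
    R00 R0D b0 b1 rho0 rho_zero) => t H _.
have [tau1 tau10 H1] := at_right0_near tail.
have [tau2 tau20 H2] := at_right0_near annulus.
exists (Num.min tau1 tau2); first by rewrite lt_min tau10.
move=> t t0; rewrite lt_min => /andP[tt1 tt2] x y Xx R0x yrho.
have kcont := kernel_continuous kernel_k t0.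
have kge0 := kernel_ge0 kernel_k t0.
have potE (A : set 'rV[R]_m) (z : 'rV[R]_m) : measurable A ->
    potential k A z t = radial_mass (k^~ t) ((fun xi => xi + z) @^-1` A).
  move=> mA; etransitivity; last exact: (integral_kernel_translate m0 kcont kge0 z mA).
  by apply: eq_integral => xi _; rewrite enorm_distC.
have mtr (z : 'rV[R]_m) (A : set 'rV[R]_m) : measurable A -> measurable ((fun xi => xi + z) @^-1` A).
  by apply: preimage_measurable; exact: measurable_fun_addv.
rewrite !potE//.
have mB r : measurable (cball (0 : 'rV[R]_m) r) by exact: measurable_cball.
apply: (@lt_le_trans _ _ (radial_mass (k^~ t) (cball (0 : 'rV[R]_m) R0))); last first.
  apply: (massS kernel_k t0) => //; first exact: mtr.
  by apply: dist_setC_cball => //; exact: body_closed.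
have [p [v [v1 pvY minp]]] := closest_cone y (body_setC_nonempty m0 bodyY) coneY.
have pdist : enorm (p - y) <= dist y (~` Y).
  apply: le_dist => [|a aY]; first exact: body_setC_nonempty.
  by rewrite (enorm_distC y); exact: minp.
have fin (A : set 'rV[R]_m) := @mass_fin_num R m alpha k m2 kernel_k t A t0.
have mC (z : 'rV[R]_m) : measurable (open_cone z v kappa delta) by exact: measurable_open_cone.
(* In both cases two decompositions of the same mass are compared: of the whole space
   when p = y, of B_D otherwise. *)
have [py|py] := eqVneq p y.
  apply: (@le_lt_trans _ _ (radial_mass (k^~ t) (~` open_cone 0 v kappa delta))).
    apply: (massS kernel_k t0) => //; [exact: mtr|exact: measurableC|].
    move=> z /= Yz Cz; apply: (pvY (z + y)) => //.
    by rewrite -(add0r p) py; apply/open_cone_translate.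
  have hC := massID kernel_k t0 measurableT (mC 0).
  have hB := massID kernel_k t0 measurableT (mB R0).
  move: hC hB; rewrite !setTI !setTD => hC hB.
  apply: (@lte_of_complements _ _ (radial_mass (k^~ t) (open_cone 0 v kappa delta)) _
    (radial_mass (k^~ t) (~` cball 0 R0))).
  - by apply: fin; exact: measurableC.
  - exact: fin.
  - exact: fin.
  - by apply: fin; exact: measurableC.
  - by rewrite addeC -hC hB.
  - exact: H1.
pose r := enorm (p - y).
have r0 : 0 < r by rewrite enorm_gt0 subr_eq0.
have rrho : r <= b * rho by exact: le_trans yrho.
have rho0 : 0 < rho by rewrite -(pmulr_rgt0 _ b0); exact: lt_le_trans rrho.
have Yy : Y y.
  apply: contrapT => nYy; have := minp y nYy; rewrite subrr enorm0.
  by rewrite leNgt r0.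
pose e := r^-1 *: (p - y).
have e1 : enorm e = 1 by apply: enorm_normalize; rewrite subr_eq0.
have re : r *: e = p - y by rewrite scalerA divff ?scale1r// gt_eqF.
have dual w : cos (kappa / 2) * enorm w < dotp w v -> 0 <= dotp w e.
  move=> wv; rewrite dotpZr mulr_ge0 ?invr_ge0 ?(ltW r0)//.
  by apply: (cone_outside_ball_dir delta0 _ wv) => z /pvY; exact: minp.
have ineq := H2 t t0 tt2 rho0 r e v r0 rrho e1 v1 dual.
pose Cr := open_cone (r *: e) v kappa delta.
apply: (@le_lt_trans _ _ (radial_mass (k^~ t) (cball 0 D `\` Cr))).
  apply: (massS kernel_k t0) => //; [exact: mtr|by apply: measurableD; [exact: mB|exact: mC]|].
  move=> z /= Yz; split.
    by rewrite /cball/= subr0 -(addrK y z); exact: diam_ge.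
  rewrite /Cr re => Cz; apply: (pvY (z + y)) => //.
  by rewrite -(subrK y p); apply/open_cone_translate.
have hC := massID kernel_k t0 (mB D) (mC (r *: e)).
have hB := massID kernel_k t0 (mB D) (mB R0).
apply: (@lte_of_complements _ _ (radial_mass (k^~ t) (Cr `&` cball 0 D)) _
  (radial_mass (k^~ t) (cball 0 D `\` cball 0 R0))).
- by apply: fin; apply: measurableD; [exact: mB|exact: mC].
- by apply: fin; apply: measurableI; [exact: mC|exact: mB].
- exact: fin.
- by apply: fin; apply: measurableD; exact: mB.
- rewrite addeC setIC -hC hB; congr (radial_mass _ _ + _)%E.
  by apply: setIidr => z; rewrite /cball/= => h; exact: le_trans h (ltW R0D).
- exact: ineq.
Unshelve. all: by end_near. Qed.
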